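(* Let $f:\mathbb{R}^2\to\mathbb{R}^2_1$ be a smooth function such that $M=\operatorname{graph} f=\{(x,f(x)):x\in\mathbb{R}^2\}\subset\mathbb{R}^4_1$ is a spacelike stationary graph, and let $W:\mathbb{R}^2\to(0,\infty)$ be its $W$-function. Then one and only one of the following three cases occurs: (i) $f$ is affine linear and $W\equiv r$ for some constant $r>0$; (ii) $f=h\,\mathbf{y}_0+\mathbf{y}_1$, where $h$ is a nonlinear (i.e. not affine linear) harmonic function on $\mathbb{R}^2$, $\mathbf{y}_0$ is a nonzero lightlike vector in $\mathbb{R}^2_1$ and $\mathbf{y}_1\in\mathbb{R}^2_1$ is a constant vector, and $W\equiv 1$; (iii) there is a number $r\in(1,+\infty)$ such that $W$ takes each value in $[r^{-1},r]$ infinitely often (i.e. at infinitely many points of $\mathbb{R}^2$). Moreover, the constants are arbitrary: for every $r>0$ there is such an $f$ in case (i) with $W\equiv r$, and for every $r\in(1,+\infty)$ there is such an $f$ in case (iii) for which $W$ takes each value in $[r^{-1},r]$ infinitely often.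
   Context: $\mathbb{R}^m_1$ denotes $\mathbb{R}^m$ with the Minkowski inner product $\langle \mathbf{u},\mathbf{v}\rangle=u_1v_1+\cdots+u_{m-1}v_{m-1}-u_mv_m$; a vector $\mathbf{y}$ is lightlike if $\langle\mathbf{y},\mathbf{y}\rangle=0$. Identify $\mathbb{R}^{2+m}_1=\mathbb{R}^2\oplus\mathbb{R}^m_1$, where $\mathbb{R}^2$ carries the Euclidean inner product. (Here $m=2$.) For smooth $f:\mathbb{R}^2\to\mathbb{R}^m_1$, put $p=\partial f/\partial x_1$, $q=\partial f/\partial x_2$. The induced metric on $M=\operatorname{graph} f\subset\mathbb{R}^{2+m}_1$ in the global coordinates $(x_1,x_2)$ is $g=g_{ij}dx_idx_j$ with $g_{11}=1+\langle p,p\rangle$, $g_{22}=1+\langle q,q\rangle$, $g_{12}=g_{21}=\langle p,q\rangle$. $M$ is spacelike if $(g_{ij})$ is positive definite at every point; then $W:=\det(g_{ij})^{1/2}>0$. A spacelike surface is stationary if its mean curvature vector field vanishes identically; equivalently, all coordinate functions of $\mathbb{R}^{2+m}_1$ restricted to $M$ are harmonic for the Laplace–Beltrami operator $\Delta F=W^{-1}\partial_i(Wg^{ij}\partial_jF)$ of $g$, where $(g^{ij})=(g_{ij})^{-1}$. ''Harmonic function on $\mathbb{R}^2$'' refers to the standard Euclidean Laplacian in $(x_1,x_2)$. *)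

(* Defs.v *)
From mathcomp Require Import all_boot all_order all_algebra.
From mathcomp Require Import all_classical all_reals all_analysis.

Set Implicit Arguments.
Unset Strict Implicit.
Unset Printing Implicit Defensive.

Import Order.TTheory GRing.Theory Num.Theory.
Import numFieldNormedType.Exports.

Local Open Scope classical_set_scope.
Local Open Scope ring_scope.

(* Minkowski inner product of R^n_1: the last coordinate is the negative one. *)
Definition mink (R : realType) (n : nat) (u v : 'rV[R]_n) : R :=
  \sum_(i < n) (-1) ^+ (i.+1 == n) * (u 0 i * v 0 i).

Definition lightlike (R : realType) (n : nat) (y : 'rV[R]_n) : Prop :=
  mink y y = 0.

Definition partial (R : realType) (V : normedModType R) (i : 'I_2)
    (F : 'rV[R]_2 -> V) : 'rV[R]_2 -> V :=
  fun x => 'D_(delta_mx 0 i) F x.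

(* [differentiable] is Frechet differentiability; a map is C^(k+1) iff it is
   Frechet differentiable with partial derivatives of class C^k. *)
Fixpoint class_C (R : realType) (V : normedModType R) (k : nat)
    (F : 'rV[R]_2 -> V) : Prop :=
  if k is k'.+1 then
    (forall x, differentiable F x) /\ (forall i, class_C k' (partial i F))
  else continuous F.

Definition smooth (R : realType) (V : normedModType R)
    (F : 'rV[R]_2 -> V) : Prop :=
  forall k, class_C k F.

Definition affine_map (R : realType) (V W : normedModType R)
    (F : V -> W) : Prop :=
  exists (L : {linear V -> W}) (b : W), forall x, F x = L x + b.

Definition harmonic_fun (R : realType) (h : 'rV[R]_2 -> R) : Prop :=
  class_C 2 h /\ forall x, \sum_(i < 2) partial i (partial i h) x = 0.

Section Graph.
Variables (R : realType) (m : nat) (f : 'rV[R]_2 -> 'rV[R]_m).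

Definition graph_map (x : 'rV[R]_2) : 'rV[R]_(2 + m) := row_mx x (f x).

Definition graph_metric (x : 'rV[R]_2) : 'M[R]_2 :=
  \matrix_(i, j) ((i == j)%:R + mink (partial i f x) (partial j f x)).

Definition spacelike : Prop :=
  forall (x v : 'rV[R]_2), v != 0 -> 0 < (v *m graph_metric x *m v^T) 0 0.

Definition Wfun (x : 'rV[R]_2) : R := Num.sqrt (\det (graph_metric x)).

(* Component of V normal to the graph at (x, f x), with respect to the
   Minkowski product of R^(2+m)_1: V - g^{kl} <V, X_k> X_l. *)
Definition normal_part (x : 'rV[R]_2) (V : 'rV[R]_(2 + m)) : 'rV[R]_(2 + m) :=
  V - \sum_(k < 2) \sum_(l < 2)
        (invmx (graph_metric x) k l * mink V (partial k graph_map x))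
          *: partial l graph_map x.

(* H = (1/2) g^{ij} II(X_i, X_j), where II(X_i, X_j) is the normal part of the
   second derivative X_ij of the parametrization X = graph_map. *)
Definition mean_curvature (x : 'rV[R]_2) : 'rV[R]_(2 + m) :=
  2^-1 *: \sum_(i < 2) \sum_(j < 2)
    invmx (graph_metric x) i j
      *: normal_part x (partial i (partial j graph_map) x).

Definition spacelike_stationary : Prop :=
  spacelike /\ forall x, mean_curvature x = 0.

End Graph.

Section Cases.
Variables (R : realType) (f : 'rV[R]_2 -> 'rV[R]_2).

Definition case_affine (r : R) : Prop :=
  affine_map f /\ forall x, Wfun f x = r.

Definition case_lightlike : Prop :=
  (exists (h : 'rV[R]_2 -> R) (y0 y1 : 'rV[R]_2),
     [/\ harmonic_fun h, ~ affine_map h, y0 != 0, lightlike y0 &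
         forall x, f x = h x *: y0 + y1]) /\
  forall x, Wfun f x = 1.

Definition case_oscillating (r : R) : Prop :=
  forall c, r^-1 <= c <= r -> infinite_set [set x | Wfun f x = c].

End Cases.

Lemma mink_row_mx (R : realType) (m : nat) (u v : 'rV[R]_2) (a b : 'rV[R]_m.+1) :
  mink (row_mx u a) (row_mx v b) = \sum_(i < 2) u 0 i * v 0 i + mink a b.
Proof.
rewrite /mink big_split_ord /=; congr (_ + _); apply: eq_bigr => i _.
- rewrite !row_mxEl /= (_ : (i.+1 == 2 + m.+1)%N = false) ?mul1r//.
  by apply/eqP => h; have := ltn_ord i; rewrite h.
- by rewrite !row_mxEr /= -addnS eqn_add2l.
Qed.

Lemma partial_graph_map (R : realType) (m : nat) (f : 'rV[R]_2 -> 'rV[R]_m)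
    (i : 'I_2) (x : 'rV[R]_2) :
  differentiable f x ->
  partial i (graph_map f) x = row_mx (delta_mx 0 i) (partial i f x).
Proof.
move=> df.
have fi : derivable f x (delta_mx 0 i) by exact: diff_derivable.
have idi : derivable (id : 'rV[R]_2 -> 'rV[R]_2) x (delta_mx 0 i).
  exact: derivable_id.
have Xl a : (fun y => graph_map f y 0 (lshift m a)) = (fun y => y 0 a).
  by apply/funext => y; rewrite /graph_map row_mxEl.
have Xr a : (fun y => graph_map f y 0 (rshift 2 a)) = (fun y => f y 0 a).
  by apply/funext => y; rewrite /graph_map row_mxEr.
have Xi : derivable (graph_map f) x (delta_mx 0 i).
  apply/derivable_mxP => a b; rewrite (ord1 a).
  case: (split_ordP b) => c ->.
    by rewrite Xl; exact: ((derivable_mxP _ _ _).1 idi 0 c).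
  by rewrite Xr; exact: ((derivable_mxP _ _ _).1 fi 0 c).
rewrite /partial derive_mx//; apply/rowP => b; rewrite mxE.
case: (split_ordP b) => c ->.
  rewrite Xl row_mxEl.
  have /(congr1 (fun M : 'rV[R]_2 => M 0 c)) := derive_mx idi.
  by rewrite derive_id => ->; rewrite mxE.
rewrite Xr row_mxEr.
have /(congr1 (fun M : 'rV[R]_m => M 0 c)) := derive_mx fi.
by move=> ->; rewrite mxE.
Qed.

(* graph_metric is the metric induced by the Minkowski product of R^(2+m)_1. *)
Lemma graph_metricE (R : realType) (m : nat) (f : 'rV[R]_2 -> 'rV[R]_m.+1)
    (x : 'rV[R]_2) (i j : 'I_2) :
  differentiable f x ->
  graph_metric f x i j =
  mink (partial i (graph_map f) x) (partial j (graph_map f) x).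
Proof.
move=> df; rewrite !partial_graph_map// mink_row_mx !mxE; congr (_ + _).
rewrite (bigD1 i)//= big1 ?addr0 => [|k /negPf ki].
  by rewrite !mxE !eqxx mul1r /= eq_sym.
by rewrite !mxE ki andbF mul0r.
Qed.

(* Main.v *)
(** Divided by its area density W, the metric is a matrix (a b; b c) of
    determinant 1, and stationarity makes (a, b) and (b, c) closed.  Lewy's map
    x + (P, Q), with grad P = (a, b) and grad Q = (b, c), is a holomorphic
    coordinate that expands distances.  Comparing holomorphic functions with
    powers of it by the maximum principle yields Liouville's theorem and unique
    continuation without uniformizing the surface.  As in Joergens' theorem, the
    Beltrami coefficient ((c - a) + 2 i b) / (a + c + 2) is holomorphic and
    bounded, so a, b and c are constant.

    In the null coordinates p = f_0 + f_1 and m = f_0 - f_1 the metric depends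
    only on the entire functions alpha = dp, beta = dm, whose product k is
    constant, and W = (a + c) / 2 + (c / 2) Re (alpha conj beta).  If k = 0, one
    of p, m is constant and W = 1.  Otherwise alpha has an entire logarithm, and
    W = (a + c) / 2 + (c |k| / 2) cos (2 arg alpha + const) with
    (c |k|)^2 = (a + c)^2 - 4; by Liouville the argument is either constant, and
    then f is affine, or takes every real value. *)
From HB Require Import structures.
Require Import Defs.
From mathcomp Require Import all_boot all_order all_algebra.
From mathcomp Require Import all_classical all_reals all_analysis.
From mathcomp Require Import ring lra.

Set Implicit Arguments.
Unset Strict Implicit.
Unset Printing Implicit Defensive.

Import Order.TTheory GRing.Theory Num.Theory.
Import numFieldNormedType.Exports.

Local Open Scope classical_set_scope.
Local Open Scope ring_scope.

(** * Calculus in the plane *)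

Section Calculus.
Variable R : realType.
Local Notation E := 'rV[R]_2.
Implicit Types (F G : E -> R) (x v : E).

(** The relations [pd 1 a = pd 0 b] and [pd 1 b = pd 0 c] say that the plane coordinates x_0 and x_1
    are harmonic for the induced metric. Holomorphic functions are handled as real pairs (s, t)
    solving a first-order system with coefficients a, b, c, so Cauchy's formula, power series and
    removable singularities are not at hand. A single comparison replaces them: if N and Z are
    squared moduli of two holomorphic functions and N / Z tends to 0 at the only zero of Z, then N /
    Z on a disc Z <= r is bounded by its values on the rim. Liouville follows by letting r grow,
    unique continuation by replacing Z with high powers. Once the structure is constant, z = x_0 + i
    (B x_0 + C x_1) is a global isothermal coordinate. The product alpha beta is then constant
    because conformality makes the Minkowski sum of the squared complex derivatives of the four
    coordinates vanish, and x_0 and x_1 contribute constants to it. *)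

Lemma sum_ord2 (V : nmodType) (F : 'I_2 -> V) : \sum_(i < 2) F i = F 0 + F 1.
Proof.
rewrite !big_ord_recl big_ord0 addr0; congr (_ + F _).
exact/val_inj.
Qed.

Lemma ord2P (i : 'I_2) : i = 0 \/ i = 1.
Proof. by case: i => [[|[|//]] ?]; [left|right]; exact/val_inj. Qed.

Lemma row2E v : v = v 0 0 *: delta_mx 0 0 + v 0 1 *: delta_mx 0 1.
Proof. by rewrite [LHS]row_sum_delta sum_ord2. Qed.

Lemma derive_partial (V : normedModType R) (F : E -> V) x v :
  differentiable F x ->
  'D_v F x = v 0 0 *: partial 0 F x + v 0 1 *: partial 1 F x.
Proof.
move=> dF; rewrite /partial !deriveE// [in LHS](row2E v).
by rewrite linearD !linearZ.
Qed.

Lemma is_derive_line F (G : E -> R) x v (t : R) :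
  is_derive (x + t *: v) v F (G (x + t *: v)) ->
  is_derive t 1 (fun t => F (x + t *: v)) (G (x + t *: v)).
Proof.
have H : (fun h => h^-1 *: ((fun t0 : R => F (x + t0 *: v)) (h *: 1 + t) -
                     F (x + t *: v))) =
         (fun h => h^-1 *: (F (h *: v + (x + t *: v)) - F (x + t *: v))).
  apply/funext => h /=; congr (_ *: (F _ - _)).
  by rewrite -[h *: 1]/(h * 1) mulr1 scalerDl addrCA.
case=> dF FG; split; first by move: dF; rewrite /derivable H.
by move: FG; rewrite /derive H.
Qed.

Lemma MVT_line F (G : E -> R) x v :
  (forall y, is_derive y v F (G y)) ->
  exists2 t : R, 0 < t < 1 & F (x + v) - F x = G (x + t *: v).
Proof.
move=> dF.
have dl (t : R) := is_derive_line (dF (x + t *: v)).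
have [|t] := @MVT R (fun t => F (x + t *: v)) (fun t => G (x + t *: v)) 0 1 ltr01 (fun t _ => dl t).
  apply: derivable_within_continuous => t _.
  exact: (@ex_derive _ _ _ _ _ _ _ (dl t)).
rewrite in_itv/= => t01.
by rewrite scale1r scale0r addr0 subr0 mulr1 => ->; exists t.
Qed.

Lemma entry_le_norm n (v : 'rV[R]_n.+1) i : `|v 0 i| <= `|v|.
Proof.
rewrite [leRHS]/Num.norm/= mx_normrE; apply/bigmax_geP.
by right; exists (0, i).
Qed.

Lemma norm_le_entry n (v : 'rV[R]_n.+1) (M : R) :
  0 <= M -> (forall i, `|v 0 i| <= M) -> `|v| <= M.
Proof.
move=> M0 vM; rewrite [leLHS]/Num.norm/= mx_normrE.
by apply/bigmax_leP; split => // -[i j] _ /=; rewrite ord1.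
Qed.
End Calculus.

(** * Functions of class C^k *)

Section Smooth.
Variable R : realType.
Local Notation E := 'rV[R]_2.
Implicit Types (F G : E -> R) (x v : E).

Lemma class_C_S (V : normedModType R) k (F : E -> V) :
  class_C k.+1 F -> class_C k F.
Proof.
elim: k F => [|k IH] F [dF pF]; first by move=> x; exact: differentiable_continuous.
by split => // i; apply: IH; exact: pF.
Qed.

Lemma smooth_differentiable (V : normedModType R) (F : E -> V) x :
  smooth F -> differentiable F x.
Proof. by move=> /(_ 1%N)[]. Qed.

Lemma smooth_partial (V : normedModType R) i (F : E -> V) :
  smooth F -> smooth (partial i F).
Proof. by move=> sF k; have [_] := sF k.+1; exact. Qed.

Lemma smooth_continuous (V : normedModType R) (F : E -> V) :
  smooth F -> continuous F.
Proof. by move=> /(_ 0%N). Qed.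

Lemma smooth_of_partials (V : normedModType R) (F : E -> V) :
  (forall x, differentiable F x) -> (forall i, smooth (partial i F)) ->
  smooth F.
Proof.
move=> dF sF [|k]; last by split => // i; exact: sF.
by move=> x; exact: differentiable_continuous.
Qed.

Lemma partialD (V : normedModType R) i (F G : E -> V) :
  (forall x, differentiable F x) -> (forall x, differentiable G x) ->
  partial i (F + G) = partial i F + partial i G.
Proof.
by move=> dF dG; apply/funext => x; rewrite /partial deriveD//; exact: diff_derivable.
Qed.

Lemma class_CD (V : normedModType R) k (F G : E -> V) :
  class_C k F -> class_C k G -> class_C k (F + G).
Proof.
elim: k F G => [|k IH] F G; first by move=> cF cG x; apply: continuousD; [exact: cF|exact: cG].
move=> [dF pF] [dG pG]; split=> [x|i]; first exact: differentiableD.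
by rewrite partialD//; apply: IH; [exact: pF|exact: pG].
Qed.

Lemma class_C_cst (V : normedModType R) k (a : V) : class_C k (cst a : E -> V).
Proof.
elim: k a => [|k IH] a; first by move=> x; exact: cst_continuous.
split=> [x|i]; first exact: differentiable_cst.
rewrite (_ : partial i _ = cst 0) //.
by apply/funext => x; rewrite /partial derive_cst.
Qed.

Lemma partialN i F : (forall x, differentiable F x) ->
  partial i (- F) = - partial i F.
Proof.
by move=> dF; apply/funext => x; rewrite /partial deriveN//; exact: diff_derivable.
Qed.

Lemma partialM i F G :
  (forall x, differentiable F x) -> (forall x, differentiable G x) ->
  partial i (F * G) = F * partial i G + G * partial i F.
Proof.
by move=> dF dG; apply/funext => x; rewrite /partial deriveM//; exact: diff_derivable.
Qed.

Lemma class_CM k F G : class_C k F -> class_C k G -> class_C k (F * G).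
Proof.
elim: k F G => [|k IH] F G; first by move=> cF cG x; apply: continuousM; [exact: cF|exact: cG].
move=> cF cG; have [dF pF] := cF; have [dG pG] := cG.
split=> [x|i]; first exact: differentiableM.
rewrite partialM//; apply: class_CD; apply: IH.
- exact: class_C_S.
- exact: pG.
- exact: class_C_S.
- exact: pF.
Qed.

Lemma partialZl (V : normedModType R) i F (a : V) :
  (forall x, differentiable F x) ->
  partial i (fun x => F x *: a) = (fun x => partial i F x *: a).
Proof.
move=> dF; apply/funext => x; rewrite /partial.
rewrite deriveE; last exact: differentiableZl.
by rewrite diffZl// deriveE.
Qed.

Lemma class_CZl (V : normedModType R) k F (a : V) :
  class_C k F -> class_C k (fun x => F x *: a).
Proof.
elim: k F => [|k IH] F.
  move=> cF x; apply: continuousZr_tmp; exact: cF.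
move=> [dF pF]; split=> [x|i]; first exact: differentiableZl.
by rewrite partialZl//; apply: IH; exact: pF.
Qed.

Definition finv F := fun x => (F x)^-1.

Lemma finvE F x : finv F x = (F x)^-1. Proof. by []. Qed.

Lemma partial_finv i F :
  (forall x, differentiable F x) -> (forall x, F x != 0) ->
  partial i (finv F) = - (finv F * finv F * partial i F).
Proof.
move=> dF F0; apply/funext => x; rewrite /partial /finv.
rewrite (@deriveV _ _ F)//; last exact: diff_derivable.
by rewrite expr2 invfM scaleNr.
Qed.

Lemma class_C_finv k F : (forall x, F x != 0) -> class_C k F ->
  class_C k (finv F).
Proof.
move=> F0; elim: k => [|k IH].
  by move=> cF x; apply: continuousV => //; exact: cF.
move=> cF; have [dF pF] := cF; have Hi := IH (class_C_S cF).
split=> [x|i]; first exact: differentiableV.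
rewrite partial_finv//.
rewrite (_ : - _ = cst (-1) * (finv F * finv F * partial i F)); last first.
  by apply/funext => x; rewrite !fctE mulN1r.
apply: class_CM; first exact: class_C_cst.
by apply: class_CM; [exact: class_CM | exact: pF].
Qed.

Lemma differentiable_sqrt F x : differentiable F x -> 0 < F x ->
  differentiable (fun y => Num.sqrt (F y)) x.
Proof.
move=> dF F0; apply: (@differentiable_comp _ _ _ _ F Num.sqrt) => //.
by apply/derivable1_diffP; apply: ex_derive; exact: is_derive1_sqrt.
Qed.

Lemma partial_sqrt i F :
  (forall x, differentiable F x) -> (forall x, 0 < F x) ->
  partial i (fun y => Num.sqrt (F y)) =
  finv (cst 2 * (fun y => Num.sqrt (F y))) * partial i F.
Proof.
move=> dF F0; apply/funext => x; rewrite /partial.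
have ds : differentiable (@Num.sqrt R) (F x).
  by apply/derivable1_diffP; apply: ex_derive; exact: is_derive1_sqrt.
rewrite deriveE; last exact: differentiable_sqrt.
rewrite (@diff_comp _ _ _ _ F Num.sqrt)//=.
rewrite deriv1E; last exact/derivable1_diffP.
rewrite -deriveE//.
rewrite derive1E derive_sqrt// /finv !fctE /=; exact: mulrC.
Qed.

Lemma class_C_sqrt k F : (forall x, 0 < F x) -> class_C k F ->
  class_C k (fun y => Num.sqrt (F y)).
Proof.
move=> F0; elim: k => [|k IH].
  move=> cF x; apply: (@continuous_comp _ _ _ F Num.sqrt); first exact: cF.
  exact: sqrt_continuous.
move=> cF; have [dF pF] := cF; have Hi := IH (class_C_S cF).
split=> [x|i]; first exact: differentiable_sqrt.
rewrite partial_sqrt//; apply: class_CM; last exact: pF.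
apply: class_C_finv; last by apply: class_CM; first exact: class_C_cst.
by move=> x; rewrite !fctE mulf_neq0// gt_eqF// sqrtr_gt0.
Qed.

Lemma is_derive_coord n (F : E -> 'rV[R]_n) (j : 'I_n) i x : differentiable F x ->
  is_derive x (delta_mx 0 i) (fun y => F y 0 j) (partial i F x 0 j).
Proof.
move=> dF; have fi : derivable F x (delta_mx 0 i) by exact: diff_derivable.
split; first exact: ((derivable_mxP _ _ _).1 fi 0 j).
by rewrite /partial derive_mx// mxE.
Qed.

Lemma differentiable_entry n (F : E -> 'rV[R]_n) (j : 'I_n) x :
  differentiable F x -> differentiable (fun y => F y 0 j) x.
Proof.
move=> dF; apply: (@differentiable_comp _ _ _ _ F (fun v : 'rV[R]_n => v 0 j)) => //.
exact: differentiable_coord.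
Qed.

Lemma partial_coord n i (F : E -> 'rV[R]_n) (j : 'I_n) x : differentiable F x ->
  partial i (fun y => F y 0 j) x = partial i F x 0 j.
Proof. by move=> /(is_derive_coord j i) dF; exact: derive_val. Qed.

Lemma class_C_coord n k (F : E -> 'rV[R]_n) (j : 'I_n) :
  class_C k F -> class_C k (fun y => F y 0 j).
Proof.
elim: k F => [|k IH] F.
  move=> cF x; apply: (@continuous_comp _ _ _ F (fun v : 'rV[R]_n => v 0 j)).
    exact: cF.
  exact: coord_continuous.
move=> [dF pF]; split=> [x|i]; first exact: differentiable_entry.
rewrite (_ : partial i _ = fun y => partial i F y 0 j); first by apply: IH; exact: pF.
by apply/funext => x; exact: partial_coord.
Qed.

Lemma class_C_id k : class_C k (id : E -> E).
Proof.
case: k => [|k]; first by move=> x; exact: cvg_id.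
split=> [x|i]; first exact: ex_diff.
rewrite (_ : partial i _ = cst (delta_mx 0 i)); first exact: class_C_cst.
by apply/funext => x; rewrite /partial derive_id.
Qed.

(** Continuity of the coefficients upgrades directional derivatives to a Frechet derivative: the
    mean value theorem along h leaves an error of at most |h| times the oscillation of A and B near
    x. *)
Lemma differentiable_of_is_derive F (A B : E -> R) :
  continuous A -> continuous B ->
  (forall x v, is_derive x v F (v 0 0 * A x + v 0 1 * B x)) ->
  forall x, differentiable F x.
Proof.
move=> cA cB dF x.
pose l (v : E) : R := v 0 0 * A x + v 0 1 * B x.
have l_lin : linear l by move=> a u v; rewrite /l !mxE /GRing.scale/=; ring.
pose lM := GRing.isLinear.Build _ _ _ _ l l_lin.
pose L : {linear E -> R} := HB.pack l lM.
have cL : continuous L.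
  move=> y; apply: (@continuousD _ _ _ (fun v : E => v 0 0 * A x) (fun v => v 0 1 * B x));
  by apply: continuousM; [exact: coord_continuous|exact: cst_continuous].
have H : F \o shift x = cst (F x) + L +o_ (nbhs (0 : E)) id.
  apply/eqaddoP => _/posnumP[e].
  have e20 : 0 < e%:num / 2 :> R by [].
  have /cvgrPdist_lt /(_ _ e20) nA := cA x.
  have /cvgrPdist_lt /(_ _ e20) nB := cB x.
  have [d /= d0 Hd] : exists2 d, 0 < d & ball x d `<=`
      [set y | `|A x - A y| < e%:num / 2 /\ `|B x - B y| < e%:num / 2].
    by apply/(@nbhs_ballP _ _ x); exact: filterI nA nB.
  apply/nbhs_ballP; exists d => //= h; rewrite -ball_normE/= sub0r normrN => hd.
  have [t /andP[t0 t1]] := MVT_line x (fun y => dF y h).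
  rewrite !fctE /= => Et.
  rewrite (_ : _ - _ = h 0 0 * (A (x + t *: h) - A x) + h 0 1 * (B (x + t *: h) - B x)); last first.
    by rewrite opprD addrA [h + x]addrC Et /l; ring.
  have /Hd[/ltW HA /ltW HB] : ball x d (x + t *: h).
    rewrite -ball_normE/= opprD addNKr normrN normrZ gtr0_norm//.
    by apply: le_lt_trans hd; rewrite ler_piMl// ltW.
  rewrite (le_trans (ler_normD _ _))// !normrM.
  rewrite [leRHS](_ : _ = `|h| * (e%:num/2) + `|h| * (e%:num/2)); last by rewrite -[`|id h|]/(`|h|); lra.
  by rewrite lerD// ler_pM// ?entry_le_norm// distrC.
have dL := diff_unique cL H.
by apply/diff_locallyP; split; rewrite dL.
Qed.

Lemma partial_of_is_derive F (A B : E -> R) :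
  (forall x v, is_derive x v F (v 0 0 * A x + v 0 1 * B x)) ->
  partial 0 F = A /\ partial 1 F = B.
Proof.
move=> dF; split; apply/funext => x; rewrite /partial derive_val.
  by rewrite !mxE/= mul1r mul0r addr0.
by rewrite !mxE/= mul1r mul0r add0r.
Qed.

Lemma smooth_of_is_derive F (A B : E -> R) : smooth A -> smooth B ->
  (forall x v, is_derive x v F (v 0 0 * A x + v 0 1 * B x)) ->
  smooth F.
Proof.
move=> sA sB dF; have [pA pB] := partial_of_is_derive dF.
apply: smooth_of_partials => [|i].
  exact: differentiable_of_is_derive (smooth_continuous sA) (smooth_continuous sB) dF.
by have [->|->] := ord2P i; rewrite ?pA ?pB.
Qed.

Lemma is_derive_smooth F x v : smooth F ->
  is_derive x v F (v 0 0 * partial 0 F x + v 0 1 * partial 1 F x).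
Proof.
move=> /(@smooth_differentiable _ F x) dF; split; first exact: diff_derivable.
exact: derive_partial.
Qed.
End Smooth.

(** A locked copy of [partial] for scalar functions, so that derivatives stay atoms under [ring] and
    [field]. *)
HB.lock Definition pd (R : realType) (i : 'I_2) (F : 'rV[R]_2 -> R) : 'rV[R]_2 -> R :=
  partial i F.

(** * Symmetry of second derivatives and conditions at a local maximum *)

Section ScalarCalculus.
Variable R : realType.
Local Notation E := 'rV[R]_2.
Implicit Types (F G : E -> R) (x v : E).

Lemma pdE i F : pd i F = partial i F. Proof. by rewrite unlock. Qed.

Lemma smooth_pd i F : smooth F -> smooth (pd i F).
Proof. by rewrite pdE; exact: smooth_partial. Qed.

Lemma smoothD F G : smooth F -> smooth G -> smooth (F + G).
Proof. by move=> sF sG k; exact: class_CD. Qed.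

Lemma smoothM F G : smooth F -> smooth G -> smooth (F * G).
Proof. by move=> sF sG k; exact: class_CM. Qed.

Lemma smooth_cst (a : R) : smooth (cst a : E -> R).
Proof. by move=> k; exact: class_C_cst. Qed.

Lemma smooth1 : smooth (1 : E -> R).
Proof. exact: smooth_cst. Qed.

Lemma smooth0 : smooth (0 : E -> R).
Proof. exact: smooth_cst. Qed.

Lemma smoothN F : smooth F -> smooth (- F).
Proof.
move=> sF; rewrite (_ : - F = cst (-1) * F); last first.
  by apply/funext => x; rewrite !fctE mulN1r.
by apply: smoothM => //; exact: smooth_cst.
Qed.

Lemma smooth_finv F : (forall x, F x != 0) -> smooth F -> smooth (finv F).
Proof. by move=> F0 sF k; exact: class_C_finv. Qed.

Lemma smooth_coord (j : 'I_2) : smooth (fun x : E => x 0 j).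
Proof. by move=> k; apply: (@class_C_coord _ _ k id); exact: class_C_id. Qed.

Lemma pdD i F G : smooth F -> smooth G -> pd i (F + G) = pd i F + pd i G.
Proof.
by move=> sF sG; rewrite !pdE partialD// => x; exact: smooth_differentiable.
Qed.

Lemma pdM i F G : smooth F -> smooth G -> pd i (F * G) = F * pd i G + G * pd i F.
Proof.
by move=> sF sG; rewrite !pdE partialM// => x; exact: smooth_differentiable.
Qed.

Lemma pdN i F : smooth F -> pd i (- F) = - pd i F.
Proof.
by move=> sF; rewrite !pdE partialN// => x; exact: smooth_differentiable.
Qed.

Lemma pd_cst i (a : R) : pd i (cst a) = cst 0.
Proof. by rewrite pdE; apply/funext => x; rewrite /partial derive_cst. Qed.

Lemma pd_finv i F : (forall x, F x != 0) -> smooth F ->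
  pd i (finv F) = - (finv F * finv F * pd i F).
Proof.
by move=> F0 sF; rewrite !pdE partial_finv// => x; exact: smooth_differentiable.
Qed.

Lemma pd_coord i (j : 'I_2) : pd i (fun x : E => x 0 j) = cst (i == j)%:R.
Proof.
apply/funext => x; rewrite pdE (@partial_coord _ _ i (id : E -> E)); last exact: ex_diff.
by rewrite /partial derive_id mxE eqxx eq_sym.
Qed.

Lemma is_derive_pd F x v : smooth F ->
  is_derive x v F ((cst (v 0 0) * pd 0 F + cst (v 0 1) * pd 1 F) x).
Proof. by rewrite !pdE; exact: is_derive_smooth. Qed.

Lemma is_derive_translate F (G : E -> R) w x v :
  is_derive (x + w) v F (G (x + w)) -> is_derive x v (fun y => F (y + w)) (G (x + w)).
Proof.
have H : (fun h : R => h^-1 *: ((fun y => F (y + w)) (h *: v + x) - F (x + w))) =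
         (fun h => h^-1 *: (F (h *: v + (x + w)) - F (x + w))).
  by apply/funext => h /=; rewrite addrA.
case=> dF FG; split; first by move: dF; rewrite /derivable H.
by move: FG; rewrite /derive H.
Qed.

(* The mixed difference quotient of F on a square is a value of either mixed
   derivative inside the square. *)
Lemma mixed_difference F (u v : E) (G : E -> R) (H : E -> R) x :
  (forall y, is_derive y u F (G y)) -> (forall y, is_derive y v G (H y)) ->
  exists s t : R, [/\ 0 < s < 1, 0 < t < 1 &
    F (x + u + v) - F (x + u) - (F (x + v) - F x) = H (x + s *: u + t *: v)].
Proof.
move=> dF dG.
have [|s s01 Es] := @MVT_line R (fun y => F (y + v) - F y) (fun y => G (y + v) - G y) x u.
  move=> y; apply: (@is_deriveB _ _ _ (fun y => F (y + v)) F).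
  exact: is_derive_translate (dF (y + v)).

have [t t01 Et] := MVT_line (x + s *: u) dG.
by exists s, t; rewrite s01 t01 -Et -Es.
Qed.

(** Schwarz's theorem by contradiction: the second difference of F over a square of side r is r^2
    times either mixed derivative, each taken at some point of the square. If the two differ by 2 e
    at x, continuity keeps each within e of its value at x, and they cannot agree. *)
Lemma pdC i j F : smooth F -> pd i (pd j F) = pd j (pd i F).
Proof.
move=> sF; apply/funext => x; apply/eqP/negPn/negP => neq.
have sij a b : smooth (pd a (pd b F)) by do 2!apply: smooth_pd.
set e := `|pd i (pd j F) x - pd j (pd i F) x| / 2.
have e0 : 0 < e by rewrite divr_gt0// normr_gt0 subr_eq0.
have /cvgrPdist_lt /(_ _ e0) n1 := smooth_continuous (sij i j) (x := x).
have /cvgrPdist_lt /(_ _ e0) n2 := smooth_continuous (sij j i) (x := x).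
have [d /= d0 Hd] : exists2 d, 0 < d & ball x d `<=`
      [set y | `|pd i (pd j F) x - pd i (pd j F) y| < e
            /\ `|pd j (pd i F) x - pd j (pd i F) y| < e].
  by apply/(@nbhs_ballP _ _ x); exact: filterI n1 n2.
have dF k G y (r : R) : smooth G -> is_derive y (r *: delta_mx 0 k) G (r * pd k G y).
  move=> sG; have := is_derive_pd y (r *: delta_mx 0 k) sG.
  rewrite !fctE !mxE/=; have [->|->] := ord2P k.
  - by rewrite /= mulr1 mulr0 mul0r addr0.
  - by rewrite /= mulr1 mulr0 mul0r add0r.
(* Both intermediate points lie within 2 r of x, hence inside the ball of radius 3 r. *)
have [r r0 dr] : exists2 r, 0 < r & d = 3 * r.
  by exists (d / 3); [rewrite divr_gt0|field].
have ddF k l y : is_derive y (r *: delta_mx 0 k) (fun y => r * pd l F y) (r * (r * pd k (pd l F) y)).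
  apply: is_derive_eq; first by apply: is_deriveZ; apply: dF; exact: smooth_pd.
  by [].
have [s1 [t1 [/andP[s10 s11] /andP[t10 t11] E1]]] :=
  mixed_difference x (fun y => dF i F y r sF) (fun y => ddF j i y).
have [s2 [t2 [/andP[s20 s21] /andP[t20 t21] E2]]] :=
  mixed_difference x (fun y => dF j F y r sF) (fun y => ddF i j y).
have near (s t : R) (k l : 'I_2) : 0 < s -> s < 1 -> 0 < t -> t < 1 ->
    ball x d (x + s *: (r *: delta_mx 0 k) + t *: (r *: delta_mx 0 l)).
  have n1' (a : 'I_2) : `|delta_mx 0 a : E| <= 1.
    apply: norm_le_entry => // b; rewrite mxE/=.
    by case: (b == a); rewrite ?normr1 ?normr0.
  move=> s0 s1' t0 t1'; rewrite -ball_normE/= -addrA opprD addNKr normrN.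
  rewrite (le_lt_trans (ler_normD _ _))// !normrZ !(gtr0_norm s0, gtr0_norm t0, gtr0_norm r0).
  have := n1' k; have := n1' l; set a := `|_|; set b := `|_|.
  have a0 : 0 <= a by exact: normr_ge0.
  have b0 : 0 <= b by exact: normr_ge0.
  move=> a1 b1.
  have h1 : s * (r * b) <= r by rewrite mulrCA ler_piMr ?mulr_ile1 ?(ltW r0) ?(ltW s0) ?(ltW s1').
  have h2 : t * (r * a) <= r by rewrite mulrCA ler_piMr ?mulr_ile1 ?(ltW r0) ?(ltW t0) ?(ltW t1').
  lra.
have [_ H1] := Hd _ (near s1 t1 i j s10 s11 t10 t11).
have [H2 _] := Hd _ (near s2 t2 j i s20 s21 t20 t21).
have H3 : pd j (pd i F) (x + s1 *: (r *: delta_mx 0 i) + t1 *: (r *: delta_mx 0 j)) =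
     pd i (pd j F) (x + s2 *: (r *: delta_mx 0 j) + t2 *: (r *: delta_mx 0 i)).
  apply: (mulfI (lt0r_neq0 r0)); apply: (mulfI (lt0r_neq0 r0)).
  by rewrite -E1 -E2 (addrAC x); ring.
suff : `|pd i (pd j F) x - pd j (pd i F) x| < e + e.
  by rewrite /e -splitr ltxx.
rewrite distrC in H1.
rewrite -(subrKA (pd i (pd j F) (x + s2 *: (r *: delta_mx 0 j) + t2 *: (r *: delta_mx 0 i)))).
by rewrite (le_lt_trans (ler_normD _ _))// ltrD// -H3.
Qed.

Definition hess F x v := v 0 0 ^+ 2 * pd 0 (pd 0 F) x
  + 2 * v 0 0 * v 0 1 * pd 0 (pd 1 F) x + v 0 1 ^+ 2 * pd 1 (pd 1 F) x.

Lemma continuous_near_gt0 F x v : continuous F -> 0 < F x ->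
  exists2 e : R, 0 < e & forall t, 0 < t < e -> 0 < F (x + t *: v).
Proof.
move=> cF F0.
have /nbhs_ballP[d /= d0 Hd] : nbhs x [set y | 0 < F y] by exact: cvgr_gt (cF x) _ F0.
exists (d / (`|v| + 1)); first by rewrite divr_gt0// ltr_wpDl.
move=> t /andP[t0 te]; apply: Hd; rewrite -ball_normE/= opprD addNKr normrN normrZ gtr0_norm//.
have v1 : 0 < `|v| + 1 by rewrite ltr_wpDl.
move: te; rewrite ltr_pdivlMr//; apply: le_lt_trans.
by rewrite ler_pM2l// lerDl.
Qed.

Lemma local_max_pd F x : smooth F -> (\forall y \near x, F y <= F x) ->
  pd 0 F x = 0 /\ pd 1 F x = 0.
Proof.
move=> sF /nbhs_ballP[d /= d0 Hd].
have H v : (cst (v 0 0) * pd 0 F + cst (v 0 1) * pd 1 F) x <= 0.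
  set D := (X in X x <= 0); rewrite leNgt; apply/negP => D0.
  have sD : smooth D.
    by apply: smoothD; apply: smoothM; try exact: smooth_cst; exact: smooth_pd.
  have [e e0 He] := continuous_near_gt0 v (smooth_continuous sD) D0.
  (* Below e the derivative stays positive, and [|t *: v| < d] keeps the comparison with F x
     available; the + 1 covers v = 0. *)
  pose t := Num.min (e / 2) (d / (`|v| + 1) / 2).
  have v1 : 0 < `|v| + 1 by rewrite ltr_wpDl.
  have t0 : 0 < t by rewrite lt_min !divr_gt0.
  have te : t < e by rewrite gt_min; apply/orP; left; lra.
  have td : `|t *: v| < d.
    rewrite normrZ gtr0_norm//.
    have : t <= d / (`|v| + 1) / 2 by rewrite ge_min lexx orbT.
    rewrite ler_pdivlMr// ler_pdivlMr// => h.
    have := mulr_ge0 (ltW t0) (normr_ge0 v); lra.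
  have [s /andP[s0 s1]] := MVT_line x (fun y => is_derive_pd y (t *: v) sF).
  have -> : (cst ((t *: v) 0 0) * pd 0 F + cst ((t *: v) 0 1) * pd 1 F) (x + s *: (t *: v))
     = t * D (x + (s * t) *: v).
    by rewrite scalerA /D !fctE !mxE; ring.
  have : F (x + t *: v) <= F x.
    by apply: Hd; rewrite -ball_normE/= opprD addNKr normrN.
  rewrite -subr_le0 => h E; move: h; rewrite E leNgt mulr_gt0// He// mulr_gt0//=.
  by apply: lt_trans te; rewrite gtr_pMl.
have H0 := H (delta_mx 0 0); have H1 := H (delta_mx 0 1).
have H2 := H (- delta_mx 0 0); have H3 := H (- delta_mx 0 1).
move: H0 H1 H2 H3; rewrite !fctE !mxE /=.
by split; lra.
Qed.

(** The first derivative D along v vanishes at x, so applying the mean value theorem twice turns F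
    (x + t v) - F x into a positive multiple of the second derivative at a nearby point, which
    cannot be positive. *)
Lemma local_max_hess F x v : smooth F -> (\forall y \near x, F y <= F x) ->
  hess F x v <= 0.
Proof.
move=> sF mF; have [F0 F1] := local_max_pd sF mF.
move: mF => /nbhs_ballP[d /= d0 Hd].
pose D := cst (v 0 0) * pd 0 F + cst (v 0 1) * pd 1 F.
pose DD := cst (v 0 0) * pd 0 D + cst (v 0 1) * pd 1 D.
have sc := @smooth_cst; have sp := smooth_pd.
have sD : smooth D by apply: smoothD; apply: smoothM; auto.
have sDD : smooth DD by apply: smoothD; apply: smoothM; auto.
have -> : hess F x v = DD x.
  rewrite /DD /D !pdD ?pdM ?pd_cst; try apply: smoothM; auto.
  rewrite (pdC 1 0 sF) !fctE /hess; ring.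
rewrite leNgt; apply/negP => DD0.
have [e e0 He] := continuous_near_gt0 v (smooth_continuous sDD) DD0.
pose t := Num.min (e / 2) (d / (`|v| + 1) / 2).
have v1 : 0 < `|v| + 1 by rewrite ltr_wpDl.
have t0 : 0 < t by rewrite lt_min !divr_gt0.
have te : t < e by rewrite gt_min; apply/orP; left; lra.
have td : `|t *: v| < d.
  rewrite normrZ gtr0_norm//.
  have : t <= d / (`|v| + 1) / 2 by rewrite ge_min lexx orbT.
  rewrite ler_pdivlMr// ler_pdivlMr// => h.
  have := mulr_ge0 (ltW t0) (normr_ge0 v); lra.
have [s /andP[s0 s1]] := MVT_line x (fun y => is_derive_pd y (t *: v) sF).
have -> : (cst ((t *: v) 0 0) * pd 0 F + cst ((t *: v) 0 1) * pd 1 F) (x + s *: (t *: v))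
   = t * D (x + (s * t) *: v).
  by rewrite scalerA /D !fctE !mxE; ring.
have [s' /andP[s'0 s'1]] := MVT_line x (fun y => is_derive_pd y ((s * t) *: v) sD).
have -> : D x = 0 by rewrite /D !fctE F0 F1; ring.
have -> : (cst (((s * t) *: v) 0 0) * pd 0 D + cst (((s * t) *: v) 0 1) * pd 1 D) (x + s' *: ((s * t) *: v))
   = s * t * DD (x + (s' * (s * t)) *: v).
  by rewrite scalerA /DD !fctE !mxE; ring.
rewrite subr0 => ->.
have : F (x + t *: v) <= F x.
  by apply: Hd; rewrite -ball_normE/= opprD addNKr normrN.
rewrite -subr_le0 => h E; move: h; rewrite E leNgt !mulr_gt0// He// !mulr_gt0//=.
have st : s * t < e by apply: lt_trans te; rewrite gtr_pMl.
by apply: lt_trans st; rewrite gtr_pMl// mulr_gt0.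
Qed.
End ScalarCalculus.

#[global] Hint Resolve smooth_pd smoothD smoothM smoothN smooth_cst smooth0 smooth1
  smooth_coord : smooth.
#[global] Hint Extern 0 (smooth _) => solve [auto 20 with smooth nocore] : core.

(** * Poincare's lemma *)

Section Poincare.
Variable R : realType.
Local Notation E := 'rV[R]_2.
Implicit Types (A B F : E -> R) (x v : E).

Lemma compact_norm_le (r : R) : compact [set y : E | `|y| <= r].
Proof.
apply: bounded_closed_compact.
  by exists r; split; [exact: num_real | move=> e re y /= yr; exact: le_trans (ltW re)].
rewrite (_ : [set _ | _] = Num.norm @^-1` [set z | z <= r])//.
apply: preimage_closed; last exact: closed_le.
by move=> y _; exact: norm_continuous.
Qed.

Lemma bounded_on_norm_le F (r : R) : continuous F -> 0 <= r ->
  exists2 M, 0 <= M & forall y, `|y| <= r -> `|F y| <= M.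
Proof.
move=> cF r0.
have [||c _ Hc] := @EVT_max_rV R 2 (fun y => `|F y|) [set y | `|y| <= r] _ (@compact_norm_le r).
- by exists 0 => /=; rewrite normr0.
- apply: continuous_subspaceT => y; apply: continuous_comp; first exact: cF.
  exact: norm_continuous.
- by exists `|F c| => // y yr; apply: Hc; rewrite inE.
Qed.

Lemma is_derive_scale F (t : R) x v (d : R) :
  is_derive (t *: x) (t *: v) F d -> is_derive x v (fun y => F (t *: y)) d.
Proof.
have H : (fun h : R => h^-1 *: ((fun y => F (t *: y)) (h *: v + x) - F (t *: x))) =
         (fun h => h^-1 *: (F (h *: (t *: v) + t *: x) - F (t *: x))).
  apply/funext => h /=; congr (_ *: (F _ - _)).
  by rewrite scalerDr !scalerA mulrC.
case=> dF FG; split; first by move: dF; rewrite /derivable H.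
by move: FG; rewrite /derive H.
Qed.

Lemma is_derive_ray F x (t : R) : smooth F ->
  is_derive t 1 (fun t => F (t *: x)) (x 0 0 * pd 0 F (t *: x) + x 0 1 * pd 1 F (t *: x)).
Proof.
move=> sF; have := is_derive_pd (0 + t *: x) x sF.
by move/(@is_derive_line R F (cst (x 0 0) * pd 0 F + cst (x 0 1) * pd 1 F) 0 x t); rewrite !add0r/=;
  under eq_fun do rewrite add0r.
Qed.

Lemma continuous_ray F x : continuous F -> continuous (fun t : R => F (t *: x)).
Proof.
move=> cF t; apply: (@continuous_comp _ _ _ (fun t : R => t *: x) F); last exact: cF.
by apply: continuousZr_tmp; exact: cvg_id.
Qed.

Definition ray_integral A B x : R :=
  \int[lebesgue_measure]_(t in `[0, 1]) (x 0 0 * A (t *: x) + x 0 1 * B (t *: x)).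

(* Closedness of A dx + B dy makes the derivative of the integrand along v equal
   to d/dt (t C(t x)), where C := v_0 A + v_1 B. *)
Lemma is_derive_ray_integrand A B (t : R) x v : smooth A -> smooth B ->
  pd 1 A = pd 0 B ->
  let C := cst (v 0 0) * A + cst (v 0 1) * B in
  is_derive x v (fun y : E => y 0 0 * A (t *: y) + y 0 1 * B (t *: y))
    (C (t *: x) + t * (x 0 0 * pd 0 C (t *: x) + x 0 1 * pd 1 C (t *: x))).
Proof.
move=> sA sB AB C.
have dc (j : 'I_2) : is_derive x v (fun y : E => y 0 j) (v 0 j).
  have -> : v 0 j = (cst (v 0 0) * pd 0 (fun y : E => y 0 j) + cst (v 0 1) * pd 1 (fun y : E => y 0 j)) x.
    rewrite !pd_coord !fctE; have [->|->] := ord2P j.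
    - by rewrite /= mulr1 mulr0 addr0.
    - by rewrite /= mulr1 mulr0 add0r.
  exact: is_derive_pd.
have dA (F : E -> R) : smooth F -> is_derive x v (fun y => F (t *: y))
    (t * ((cst (v 0 0) * pd 0 F + cst (v 0 1) * pd 1 F) (t *: x))).
  move=> sF; apply: is_derive_scale; apply: is_derive_eq; first exact: is_derive_pd.
  by rewrite !fctE !mxE; ring.
apply: is_derive_eq.
  apply: (@is_deriveD _ _ _ (fun y : E => y 0 0 * A (t *: y)) (fun y : E => y 0 1 * B (t *: y))).
    by apply: (@is_deriveM _ _ (fun y : E => y 0 0) (fun y : E => A (t *: y))); do ?[exact: dc|exact: dA].
  by apply: (@is_deriveM _ _ (fun y : E => y 0 1) (fun y : E => B (t *: y))); do ?[exact: dc|exact: dA].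
rewrite /C !pdD// !pdM// !pd_cst !fctE AB /GRing.scale/=; ring.
Qed.

(** Differentiation under the integral sign along v replaces the integrand by d/dt (t C(t x)), and
    the fundamental theorem of calculus leaves C(x). *)
Lemma is_derive_ray_integral A B : smooth A -> smooth B -> pd 1 A = pd 0 B ->
  forall x v, is_derive x v (ray_integral A B) (v 0 0 * A x + v 0 1 * B x).
Proof.
move=> sA sB AB x v.
pose C := cst (v 0 0) * A + cst (v 0 1) * B.
have sC : smooth C by rewrite /C.
pose g (t : R) (y : E) := y 0 0 * A (t *: y) + y 0 1 * B (t *: y).
pose K (t : R) (y : E) := C (t *: y) + t * (y 0 0 * pd 0 C (t *: y) + y 0 1 * pd 1 C (t *: y)).
have dg (h t : R) : is_derive h 1 (fun h => g t (x + h *: v)) (K t (x + h *: v)).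
  by apply: (@is_derive_line R (g t) (K t)); exact: is_derive_ray_integrand.
have cr F y : smooth F -> continuous (fun t : R => F (t *: y)).
  by move=> sF; apply: continuous_ray; exact: smooth_continuous.
have clin (F G : E -> R) (y : E) : smooth F -> smooth G ->
    continuous (fun t : R => y 0 0 * F (t *: y) + y 0 1 * G (t *: y)).
  move=> sF sG t; apply: cvgD; apply: cvgM; try exact: cvg_cst; exact: cr.
have cg y : continuous (g ^~ y) by exact: clin.
have cK y : continuous (K ^~ y).
  move=> t; apply: cvgD; first exact: cr.
  by apply: cvgM; [exact: cvg_id|apply: clin; exact: smooth_pd].
(* All points t (x + h v) with |h| < 1 and 0 <= t <= 1 lie in the ball of radius r; bounds for C and
   its derivatives there yield the constant dominating function M. *)
pose r := `|x| + `|v|.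
have r0 : 0 <= r by rewrite addr_ge0.
have [M0 M00 HM0] := bounded_on_norm_le (smooth_continuous sC) r0.
have [M1 M10 HM1] := bounded_on_norm_le (smooth_continuous (smooth_pd 0 sC)) r0.
have [M2 M20 HM2] := bounded_on_norm_le (smooth_continuous (smooth_pd 1 sC)) r0.
pose M := M0 + (r * M1 + r * M2).
have Mge0 : 0 <= M by rewrite !addr_ge0// mulr_ge0.
have KM (h t : R) : -1 < h < 1 -> 0 <= t <= 1 -> `|K t (x + h *: v)| <= M.
  move=> /andP[h0 h1] /andP[t0 t1].
  have yr : `|x + h *: v| <= r.
    rewrite (le_trans (ler_normD _ _))// lerD2l normrZ ler_piMl//.
    by rewrite ler_norml !ltW.
  have tyr : `|t *: (x + h *: v)| <= r.
    by rewrite normrZ ger0_norm//; apply: le_trans yr; rewrite ler_piMl.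
  have ey (i : 'I_2) : `|(x + h *: v) 0 i| <= r by apply: le_trans yr; exact: entry_le_norm.
  rewrite /K (le_trans (ler_normD _ _))// lerD ?HM0// normrM ger0_norm//.
  apply: (@le_trans _ _ (1 * (r * M1 + r * M2))); last by rewrite mul1r.
  rewrite ler_pM// (le_trans (ler_normD _ _))// !normrM.
  by rewrite lerD// ler_pM// ?HM1 ?HM2.
have K0 : \int[lebesgue_measure]_(t in `[0, 1]) K t x = C x.
  have dF (t : R) : is_derive t 1 (fun t => t * C (t *: x)) (K t x).
    apply: is_derive_eq.
      by apply: (@is_deriveM _ _ (fun t : R => t) (fun t => C (t *: x))); exact: is_derive_ray.
    by rewrite /K /GRing.scale/= mulr1 addrC.
  rewrite /Rintegral (@continuous_FTC2 _ _ (fun t => t * C (t *: x)))//=.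
  - by rewrite scale1r mul1r mul0r subr0.
  - exact: continuous_subspaceT.
  - have cF : continuous (fun t : R => t * C (t *: x)).
      by move=> t; apply: cvgM; [exact: cvg_id|exact: cr].
    split.
    + by move=> t _; apply: ex_derive.
    + by apply: cvg_at_right_filter; exact: cF.
    + by apply: cvg_at_left_filter; exact: cF.
  - by move=> t _; rewrite derive1E derive_val.
have I0 : (`]-1, 1[%classic : set R) 0 by rewrite /= in_itv/=; apply/andP; split; lra.
have pK (h t : R) : partial1of2 (fun h t => g t (x + h *: v)) h t = K t (x + h *: v).
  by rewrite partial1of2E derive_val.
have := @cvg_differentiation_under_integral R _ _ lebesgue_measure
  (fun h t => g t (x + h *: v)) `[0, 1]%classic (measurable_itv _) 0 (-1) 1 I0.
move=> /(_ _ _ (cst M)) H.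
have {}H : h^-1 *: (ray_integral A B (h *: v + x) - ray_integral A B x) @[h --> 0^'] --> C x.
  have -> : (fun h : R => h^-1 *: (ray_integral A B (h *: v + x) - ray_integral A B x)) =
     (fun h => h^-1 *: (\int[lebesgue_measure]_(y in `[0, 1]) g y (x + (h + 0) *: v) -
                   \int[lebesgue_measure]_(y in `[0, 1]) g y (x + 0 *: v))).
    by apply/funext => h; rewrite addr0 scale0r addr0 (addrC x).
  rewrite -K0.
  have -> : \int[lebesgue_measure]_(t in `[0, 1]) K t x =
     \int[lebesgue_measure]_(t in `[0, 1]) partial1of2 (fun h t => g t (x + h *: v)) 0 t.
    by apply: eq_Rintegral => t _; rewrite pK scale0r addr0.
  apply: H => //.
  - move=> h _; apply: continuous_compact_integrable; first exact: segment_compact.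
    by apply: continuous_subspaceT; exact: cg.
  - apply: continuous_compact_integrable; first exact: segment_compact.
    by apply: continuous_subspaceT; exact: cst_continuous.
  - by move=> h t; rewrite /= !in_itv/= pK; exact: KM.
split; first by apply/cvg_ex; exists (C x).
by rewrite /derive; apply/cvg_lim.
Qed.

Lemma poincare A B : smooth A -> smooth B -> pd 1 A = pd 0 B ->
  exists P : E -> R, [/\ smooth P, pd 0 P = A & pd 1 P = B].
Proof.
move=> sA sB AB; have dP := is_derive_ray_integral sA sB AB.
exists (ray_integral A B); rewrite !pdE; have [-> ->] := partial_of_is_derive dP.
by split=> //; exact: smooth_of_is_derive dP.
Qed.
End Poincare.

(** * Holomorphic pairs for a conformal structure *)

(** Derives L = M from given equations by exhibiting the coefficients of a linear combination, which
    [ring] or [field] then verifies. Stated over any commutative ring, so that it applies to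
    functions as well as to numbers. *)
Lemma lincomb1 (V : comPzRingType) (k L M A B : V) :
  A = B -> L - M = k * (A - B) -> L = M.
Proof. by move=> ->; rewrite subrr mulr0 => /eqP; rewrite subr_eq0 => /eqP. Qed.

Lemma lincomb2 (V : comPzRingType) (k k' L M A B A' B' : V) :
  A = B -> A' = B' -> L - M = k * (A - B) + k' * (A' - B') -> L = M.
Proof.
by move=> -> ->; rewrite !subrr !mulr0 addr0 => /eqP; rewrite subr_eq0 => /eqP.
Qed.

Lemma lincomb3 (V : comPzRingType) (k k' k'' L M A B A' B' A'' B'' : V) :
  A = B -> A' = B' -> A'' = B'' ->
  L - M = k * (A - B) + k' * (A' - B') + k'' * (A'' - B'') -> L = M.
Proof.
by move=> -> -> ->; rewrite !subrr !mulr0 !addr0 => /eqP; rewrite subr_eq0 => /eqP.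
Qed.

Lemma lincomb4 (V : comPzRingType) (k1 k2 k3 k4 L M A1 B1 A2 B2 A3 B3 A4 B4 : V) :
  A1 = B1 -> A2 = B2 -> A3 = B3 -> A4 = B4 ->
  L - M = k1 * (A1 - B1) + k2 * (A2 - B2) + k3 * (A3 - B3) + k4 * (A4 - B4) ->
  L = M.
Proof.
by move=> -> -> -> ->; rewrite !subrr !mulr0 !addr0 => /eqP; rewrite subr_eq0 => /eqP.
Qed.

Arguments lincomb1 {V} k {L M A B}.
Arguments lincomb2 {V} k k' {L M A B A' B'}.
Arguments lincomb3 {V} k k' k'' {L M A B A' B' A'' B''}.
Arguments lincomb4 {V} k1 k2 k3 k4 {L M A1 B1 A2 B2 A3 B3 A4 B4}.

Section Holomorphic.
Variables (R : realType) (a b c : 'rV[R]_2 -> R).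
Local Notation E := 'rV[R]_2.
Implicit Types (F G H s t : E -> R) (x v : E).

(* The matrix (a b; b c) is the metric divided by its area density; [s + i t]
   is holomorphic for its conformal structure. *)
Definition hol s t := [/\ smooth s, smooth t,
  pd 0 t = b * pd 0 s - a * pd 1 s & pd 1 t = c * pd 0 s - b * pd 1 s].

(** The Laplace-Beltrami operator times W: since W g^{ij} is the matrix (c -b; -b a), the divergence
    form ∂_i (W g^{ij} ∂_j F) loses its first-order terms when x_0 and x_1 are harmonic. *)
Definition lap F : E -> R :=
  c * pd 0 (pd 0 F) - b * (pd 0 (pd 1 F) + pd 0 (pd 1 F)) + a * pd 1 (pd 1 F).

(** The pairing of the gradients of F and G for the metric, times W. *)
Definition gam F G : E -> R :=
  c * (pd 0 F * pd 0 G) - b * (pd 0 F * pd 1 G + pd 1 F * pd 0 G)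
  + a * (pd 1 F * pd 1 G).

Lemma pdB i F G : smooth F -> smooth G -> pd i (F - G) = pd i F - pd i G.
Proof. by move=> sF sG; rewrite pdD// pdN. Qed.

Lemma lapD F G : smooth F -> smooth G -> lap (F + G) = lap F + lap G.
Proof. by move=> sF sG; rewrite /lap !pdD//; ring. Qed.

Lemma lapM F G : smooth F -> smooth G ->
  lap (F * G) = F * lap G + G * lap F + (gam F G + gam F G).
Proof.
move=> sF sG; rewrite /lap /gam !(pdM, pdD)//.
by ring.
Qed.

Lemma lap_cst (k : R) : lap (cst k) = cst 0.
Proof.
rewrite /lap !pd_cst; apply/funext => x; rewrite !fctE; ring.
Qed.

Lemma gam_cst (k : R) F : gam (cst k) F = cst 0.
Proof. by rewrite /gam !pd_cst; apply/funext => x; rewrite !fctE; ring. Qed.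

Lemma gamC F G : gam F G = gam G F.
Proof. by rewrite /gam; ring. Qed.

Lemma gamMl F G H : smooth F -> smooth G ->
  gam (F * G) H = F * gam G H + G * gam F H.
Proof. by move=> sF sG; rewrite /gam !pdM//; ring. Qed.

Lemma gamDl F G H : smooth F -> smooth G -> gam (F + G) H = gam F H + gam G H.
Proof. by move=> sF sG; rewrite /gam !pdD//; ring. Qed.

Hypotheses (sa : smooth a) (sb : smooth b) (sc : smooth c).
Hypothesis det1 : a * c - b * b = 1.
Hypothesis closed_ab : pd 1 a = pd 0 b.
Hypothesis closed_bc : pd 1 b = pd 0 c.
Hypothesis c_gt0 : forall x, 0 < c x.

Lemma detE x : a x * c x = 1 + b x * b x.
Proof.
have := congr1 (@^~ x) det1; rewrite !fctE => /eqP.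
by rewrite subr_eq => /eqP.
Qed.

(** Multiplication by -i; determinant 1 allows the system to be solved for the derivatives of s. *)
Lemma hol_rot s t : hol s t -> hol t (- s).
Proof.
move=> [ss st t0 t1]; split=> //; rewrite pdN// t0 t1.
  by apply: (lincomb1 (pd 0 s) det1); ring.
by apply: (lincomb1 (pd 1 s) det1); ring.
Qed.

Lemma hol_D s t s' t' : hol s t -> hol s' t' -> hol (s + s') (t + t').
Proof.
by move=> [ss st t0 t1] [ss' st' t0' t1']; split=> //; rewrite !pdD// ?t0 ?t1 ?t0' ?t1'; ring.
Qed.

Lemma hol_cst (k l : R) : hol (cst k) (cst l).
Proof.
by split=> //; rewrite !pd_cst; apply/funext => x; rewrite !fctE; ring.
Qed.

Lemma hol_M s t s' t' : hol s t -> hol s' t' -> hol (s * s' - t * t') (s * t' + t * s').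
Proof.
move=> h h'; have [_ _ r0 r1] := hol_rot h; have [_ _ r0' r1'] := hol_rot h'.
move: h h' r0 r1 r0' r1' => [ss st t0 t1] [ss' st' t0' t1'].
rewrite !pdN// => r0 r1 r0' r1'.
split=> //; rewrite !(pdB, pdD, pdM)//.
  by apply: (lincomb4 s s' (- t') (- t) t0' t0 r0 r0'); ring.
by apply: (lincomb4 s s' (- t') (- t) t1' t1 r1 r1'); ring.
Qed.

(** Equality of the mixed derivatives of t, where the first-order terms cancel by closedness. *)
Lemma lap_hol s t : hol s t -> lap s = 0.
Proof.
move=> [ss st t0 t1]; have := pdC 0 1 st; rewrite t0 t1 !pdB// !pdM//.
rewrite closed_ab closed_bc (pdC 1 0 ss) => H.
by apply: (lincomb1 1 H); rewrite /lap; ring.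
Qed.

Lemma lap_holr s t : hol s t -> lap t = 0.
Proof. by move=> /hol_rot/lap_hol. Qed.

Lemma gam_hol s t : hol s t -> gam t t = gam s s.
Proof.
move=> [ss st t0 t1]; rewrite /gam t0 t1.
by apply: (lincomb1 (gam s s) det1); rewrite /gam; ring.
Qed.

Lemma gam_hol0 s t : hol s t -> gam s t = 0.
Proof. by move=> [ss st t0 t1]; rewrite /gam t0 t1; ring. Qed.

Lemma lap_sqnorm s t : hol s t ->
  lap (s * s + t * t) = gam s s + gam s s + (gam s s + gam s s).
Proof.
move=> h; have [ss st _ _] := h.
by rewrite lapD// !lapM// (lap_hol h) (lap_holr h) (gam_hol h); ring.
Qed.

(** With [lap_sqnorm] this gives N lap N = gam N N for N = |s + i t|^2, that is, log N is harmonic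
    off the zeros. *)
Lemma gam_sqnorm s t : hol s t ->
  gam (s * s + t * t) (s * s + t * t) =
  (s * s + t * t) * (gam s s + gam s s + (gam s s + gam s s)).
Proof.
move=> h; have [ss st _ _] := h.
rewrite gamDl// !gamMl// ![gam _ (_ + _)]gamC !gamDl// !gamMl// (gam_hol h).
by rewrite (gamC t s) (gam_hol0 h); ring.
Qed.

(** The identity |(F^2)'|^2 = 4 |F|^2 |F'|^2; it keeps the derivative of repeated squares nonzero
    away from their zero. *)
Lemma gam_sq s t : hol s t ->
  gam (s * s - t * t) (s * s - t * t) =
  (s * s + t * t) * (gam s s + gam s s + (gam s s + gam s s)).
Proof.
move=> h; have [ss st _ _] := h.
rewrite /gam !(pdB, pdM)//.
have H1 := gam_hol h; have H2 := gam_hol0 h.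
apply: (lincomb2 (t * t + t * t + (t * t + t * t))
  (- (s * t + s * t + (s * t + s * t)) - (s * t + s * t + (s * t + s * t))) H1 H2).
by rewrite /gam; ring.
Qed.

(** Completing the square with a c - b^2 = 1 writes c lap F as a sum of two second directional
    derivatives, both nonpositive at a maximum. *)
Lemma local_max_lap F x : smooth F -> (\forall y \near x, F y <= F x) ->
  lap F x <= 0.
Proof.
move=> sF mF; have c0 := c_gt0 x.
have h1 := local_max_hess (c x *: delta_mx 0 0 - b x *: delta_mx 0 1) sF mF.
have h2 := local_max_hess (delta_mx 0 1) sF mF.
have d := detE x.
rewrite -(pmulr_rle0 _ c0).
have -> : c x * lap F x = hess F x (c x *: delta_mx 0 0 - b x *: delta_mx 0 1)
    + hess F x (delta_mx 0 1).
  rewrite /hess !mxE/= /lap !fctE.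
  by apply: (lincomb1 (pd 1 (pd 1 F) x) d); ring.
by rewrite -[leRHS]addr0 lerD.
Qed.

Lemma gam_gt0 F x : c x * pd 0 F x - b x * pd 1 F x != 0 -> 0 < gam F F x.
Proof.
move=> n0; have c0 := c_gt0 x.
have d := detE x.
rewrite -(pmulr_rgt0 _ c0).
have -> : c x * gam F F x = (c x * pd 0 F x - b x * pd 1 F x) ^+ 2 + pd 1 F x ^+ 2.
  by rewrite /gam !fctE; apply: (lincomb1 (pd 1 F x ^+ 2) d); ring.
by rewrite ltr_pwDl ?sqr_ge0// exprn_even_gt0.
Qed.
End Holomorphic.

(** * Liouville's theorem *)

Section QuotientMax.
Variables (R : realType) (a b c : 'rV[R]_2 -> R).
Local Notation E := 'rV[R]_2.
Hypotheses (sa : smooth a) (sb : smooth b) (sc : smooth c).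
Hypothesis det1 : a * c - b * b = 1.
Hypothesis closed_ab : pd 1 a = pd 0 b.
Hypothesis closed_bc : pd 1 b = pd 0 c.
Hypothesis c_gt0 : forall x, 0 < c x.
Local Notation hol := (hol a b c).
Local Notation gm := (gam a b c).
Local Notation lap := (lap a b c).

(* At an interior maximum x of N/Z + k Z with value m, the function
   N + k Z^2 - m Z has a local maximum; there
   (m - k Z) lap(N + k Z^2 - m Z) = 4 k m Z gm xi xi > 0. *)
Lemma no_interior_max (s t xi eta : E -> R) (k m : R) x :
  hol s t -> hol xi eta ->
  let N := s * s + t * t in let Z := xi * xi + eta * eta in
  0 < k -> 0 < m -> 0 < Z x -> 0 < gm xi xi x ->
  N x + k * Z x ^+ 2 - m * Z x = 0 ->
  ~ (\forall y \near x, N y + k * Z y ^+ 2 - m * Z y <= 0).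
Proof.
move=> hst hxe N Z k0 m0 Z0 g0 Nx mN.
have [ss st _ _] := hst; have [sx se _ _] := hxe.
have sN : smooth N by rewrite /N.
have sZ : smooth Z by rewrite /Z.
pose F := N + cst k * (Z * Z) + cst (- m) * Z.
have sF : smooth F by rewrite /F.
have FE y : F y = N y + k * Z y ^+ 2 - m * Z y by rewrite /F !fctE; ring.
have mF : \forall y \near x, F y <= F x.
  by rewrite FE Nx; near=> y; rewrite FE; near: y.
have LF := local_max_lap det1 c_gt0 sF mF.
have [F0 F1] := local_max_pd sF mF.
have LN := lap_sqnorm sa sb sc det1 closed_ab closed_bc hst; rewrite -/N in LN.
have GN := gam_sqnorm det1 hst; rewrite -/N in GN.
have LZ := lap_sqnorm sa sb sc det1 closed_ab closed_bc hxe; rewrite -/Z in LZ.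
have GZ := gam_sqnorm det1 hxe; rewrite -/Z in GZ.
have N0 : 0 <= N x by rewrite /N !fctE addr_ge0// -expr2 sqr_ge0.
clearbody N Z.
have LFE : lap F x = lap N x + k * (2 * Z x * lap Z x + 2 * gm Z Z x) - m * lap Z x.
  rewrite /F !lapD// !lapM// !lap_cst !gam_cst !fctE; ring.
have pN i : pd i F x = 0 -> pd i N x = (m - 2 * k * Z x) * pd i Z x.
  rewrite /F !pdD// !pdM// !pd_cst !fctE => h.
  by apply: (lincomb1 1 h); ring.
have GNE : gm N N x = (m - 2 * k * Z x) ^+ 2 * gm Z Z x.
  by rewrite /gam !fctE /= (pN 0 F0) (pN 1 F1); ring.
move: GNE LFE; rewrite GN GZ LN LZ !fctE.
set g := gm s s x; set z := gm xi xi x => E1 E2.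
have NE : N x = Z x * (m - k * Z x) by apply: (lincomb1 1 Nx); ring.
have mk : 0 <= m - k * Z x by rewrite -(pmulr_rge0 _ Z0) -NE.
(* At the critical point grad N = (m - 2 k Z) grad Z; inserting [gam_sqnorm] for N and for Z and
   dividing by 4 Z relates the two energies. *)
have E3 : (m - k * Z x) * g = (m - 2 * k * Z x) ^+ 2 * z.
  apply: (mulfI (lt0r_neq0 Z0)).
  by move: E1; rewrite NE => E1; apply: (lincomb1 (1 / 4) E1); field.
have : 0 < 4 * k * m * Z x * z by rewrite !mulr_gt0.
have : (m - k * Z x) * lap F x <= 0 by rewrite mulr_ge0_le0.
have -> : (m - k * Z x) * lap F x = 4 * k * m * Z x * z.
  by rewrite E2; apply: (lincomb1 4 E3); ring.
by move=> h /lt_le_trans /(_ h); rewrite ltxx.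
Unshelve. all: by end_near. Qed.

(** Since log (N / Z) is harmonic, N / Z should be largest on the rim Z = r, where it is at most M /
    r. Adding k Z makes the maximum principle strict, and [small] makes the quotient tend to 0 at
    x0, so that x0 is no competitor. *)
Lemma quotient_max (s t xi eta : E -> R) x0 (r M : R) :
  hol s t -> hol xi eta ->
  let N := s * s + t * t in let Z := xi * xi + eta * eta in
  Z x0 = 0 -> (forall x, x != x0 -> 0 < Z x) ->
  (forall x, x != x0 -> 0 < gm xi xi x) ->
  0 < r -> compact [set x | Z x <= r] ->
  (forall e, 0 < e -> \forall y \near x0, N y <= e * Z y) ->
  (forall y, Z y <= r -> N y <= M) ->
  forall x, Z x <= r -> N x <= M / r * Z x.
Proof.
move=> hst hxe N Z Z0 Zgt0 g0 r0 cpt small NM x xr.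
have [ss st _ _] := hst; have [sx se _ _] := hxe.
have cN : continuous N by apply: smooth_continuous; rewrite /N.
have cZ : continuous Z by apply: smooth_continuous; rewrite /Z.
have N0 y : 0 <= N y by rewrite /N !fctE addr_ge0// -expr2 sqr_ge0.
have Zge0 y : 0 <= Z y by rewrite /Z !fctE addr_ge0// -expr2 sqr_ge0.
have M0 : 0 <= M by apply: le_trans (N0 x) (NM _ xr).
have [->|xx0] := eqVneq x x0.
  by have /nbhs_singleton := small 1 ltr01; rewrite Z0 !mulr0.
rewrite leNgt; apply/negP => Nx.
have zx := Zgt0 _ xx0.
(* Half of the slack: the rim value of the perturbed quotient is at most M / r + k r, still below N
   x / Z x. *)
pose k := (N x / Z x - M / r) / (2 * r).
have k0 : 0 < k by rewrite divr_gt0 ?mulr_gt0// subr_gt0 ltr_pdivlMr.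
have kE : M / r + 2 * (k * r) = N x / Z x by rewrite /k; field; rewrite ?gt_eqF.
clearbody k.
(* Division by zero yields 0, so q x0 = 0, which is exactly the limit provided by [small]; hence q
   is continuous at x0 too. *)
pose q y := N y / Z y + k * Z y.
have qx0 : q x0 = 0 by rewrite /q Z0 invr0 !mulr0 addr0.
have cq : continuous q.
  move=> y; have [->|yx0] := eqVneq y x0.
    suff : q @ nbhs x0 --> q x0 by [].
    apply/cvgrPdist_le => e e0.
    have e20 : 0 < e / 2 by rewrite divr_gt0.
    have ek0 : 0 < e / 2 / k by rewrite (divr_gt0 e20 k0).
    near=> w.
    rewrite qx0 sub0r normrN ger0_norm; last first.
      by rewrite addr_ge0 ?divr_ge0 ?mulr_ge0// ltW.
    rewrite (splitr e); apply: lerD.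
      have [w0|wx0] := eqVneq w x0; first by rewrite w0 Z0 invr0 mulr0 ltW.
      rewrite ler_pdivrMr ?Zgt0//; near: w; exact: small.
    rewrite mulrC -ler_pdivlMr//; near: w.
    by apply: (cvgr_le (Z x0)); [exact: cZ|rewrite Z0].
  apply: (@continuousD _ _ _ (fun w => N w / Z w) (fun w => k * Z w)); last first.
    by apply: (@continuousM _ _ (cst k) Z); [exact: cst_continuous|exact: cZ].
  apply: (@continuousM _ _ N (fun y => (Z y)^-1)); first exact: cN.
  by apply: continuousV; [rewrite gt_eqF// Zgt0|exact: cZ].
have [||y1 y1r y1max] := @EVT_max_rV R 2 q [set x | Z x <= r] _ cpt.
- by exists x0 => /=; rewrite Z0 ltW.
- exact: continuous_subspaceT.
rewrite inE/= in y1r.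
have qx : M / r + k * r < q y1.
  apply: (@lt_le_trans _ _ (q x)); last by apply: y1max; rewrite inE.
  rewrite /q.
  have := mulr_gt0 k0 zx; have := mulr_gt0 k0 r0; lra.
have q0 : 0 < q y1 by apply: le_lt_trans qx; rewrite addr_ge0 ?divr_ge0 ?mulr_ge0// ltW.
have y1x0 : y1 != x0 by apply: contraTneq q0 => ->; rewrite qx0 ltxx.
have Zy1 := Zgt0 _ y1x0.
have y1r' : Z y1 < r.
  rewrite lt_neqAle y1r andbT; apply: contraTneq qx => Zr.
  by rewrite -leNgt /q Zr lerD2r ler_pM2r ?invr_gt0// NM// Zr.
apply: (@no_interior_max s t xi eta k (q y1) y1) => //.
- exact: g0.
- rewrite -/N -/Z /q; field; rewrite gt_eqF//.
near=> w; rewrite -/N -/Z.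
have wr : Z w <= r by near: w; apply: (cvgr_le (Z y1)); [exact: cZ|].
have wx0 : 0 < Z w by near: w; apply: (cvgr_gt (Z y1)); [exact: cZ|].
have : q w <= q y1 by apply: y1max; rewrite inE.
rewrite -(ler_pM2r wx0) {1}/q -subr_le0.
by apply: le_trans; rewrite le_eqVlt; apply/orP; left; apply/eqP; field; rewrite gt_eqF.
Unshelve. all: by end_near. Qed.
End QuotientMax.

(** * Lewy's coordinate, Liouville's theorem and unique continuation *)

Section Liouville.
Variables (R : realType) (a b c : 'rV[R]_2 -> R).
Local Notation E := 'rV[R]_2.
Hypotheses (sa : smooth a) (sb : smooth b) (sc : smooth c).
Hypothesis det1 : a * c - b * b = 1.
Hypothesis closed_ab : pd 1 a = pd 0 b.
Hypothesis closed_bc : pd 1 b = pd 0 c.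
Hypothesis c_gt0 : forall x, 0 < c x.
Local Notation hol := (hol a b c).
Local Notation gm := (gam a b c).

Lemma hol_N s t : hol s t -> hol (- s) (- t).
Proof. by move=> h; do 2!apply: (hol_rot det1). Qed.

Lemma a_gt0 x : 0 < a x.
Proof.
by rewrite -(pmulr_lgt0 _ (c_gt0 x)) (detE det1) ltr_pwDl// -expr2 sqr_ge0.
Qed.

Lemma hol_inv s t : hol s t -> (forall x, (s * s + t * t) x != 0) ->
  hol (s * finv (s * s + t * t)) (- (t * finv (s * s + t * t))).
Proof.
move=> h n0; have [_ _ r0 r1] := hol_rot det1 h.
move: h r0 r1 => [ss st t0 t1]; rewrite !pdN// => r0 r1.
set n := s * s + t * t; set m := finv n.
have sn : smooth n by rewrite /n.
have sm : smooth m by exact: smooth_finv.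
have mn : m * n = 1 by apply/funext => x; rewrite /m fctE finvE mulVf.
have pm i : pd i m = - (m * m * (s * pd i s + s * pd i s + (t * pd i t + t * pd i t))).
  by rewrite /m pd_finv// /n !pdD// !pdM//.
have pS i : pd i (s * m) = m * m * (pd i s * (t * t - s * s) - (s * t + s * t) * pd i t).
  rewrite pdM// pm; apply: (lincomb1 (- m * pd i s) mn); rewrite /n; ring.
have pT i : pd i (- (t * m)) = m * m * (pd i t * (t * t - s * s) + (s * t + s * t) * pd i s).
  rewrite pdN// pdM// pm; apply: (lincomb1 (m * pd i t) mn); rewrite /n; ring.
split; [by []|by []|rewrite pT !pS..].
  by apply: (lincomb2 (m * m * (t * t - s * s)) (- (m * m * (s * t + s * t))) t0 r0); ring.
by apply: (lincomb2 (m * m * (t * t - s * s)) (- (m * m * (s * t + s * t))) t1 r1); ring.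
Qed.

Lemma sq_norm_le (v : E) : `|v| ^+ 2 <= v 0 0 ^+ 2 + v 0 1 ^+ 2.
Proof.
rewrite -[leRHS]sqr_sqrtr ?addr_ge0 ?sqr_ge0// ler_sqr ?nnegrE ?sqrtr_ge0//.
apply: norm_le_entry => [|i]; first exact: sqrtr_ge0.
rewrite -sqrtr_sqr ler_sqrt ?addr_ge0 ?sqr_ge0//.
have [->|->] := ord2P i.
- by rewrite lerDl sqr_ge0.
- by rewrite lerDr sqr_ge0.
Qed.

(* Lewy's transformation: if grad P = (a, b) and grad Q = (b, c), then
   (x_0 + P) + i (x_1 + Q) is holomorphic, and it expands distances because
   (P, Q) is a monotone field. *)
Lemma expanding_coord : exists X Y : E -> R, [/\ hol X Y,
  forall x v, `|v| ^+ 2 <= (X (x + v) - X x) ^+ 2 + (Y (x + v) - Y x) ^+ 2 &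
  forall x, 0 < gm X X x].
Proof.
have [P [sP P0 P1]] := poincare sa sb closed_ab.
have [Q [sQ Q0 Q1]] := poincare sb sc closed_bc.
pose X := (fun x : E => x 0 0) + P; pose Y := (fun x : E => x 0 1) + Q.
have sX : smooth X by rewrite /X.
have sY : smooth Y by rewrite /Y.
have pX0 : pd 0 X = cst 1 + a by rewrite pdD// pd_coord P0.
have pX1 : pd 1 X = cst 0 + b by rewrite pdD// pd_coord P1.
have pY0 : pd 0 Y = cst 0 + b by rewrite pdD// pd_coord Q0.
have pY1 : pd 1 Y = cst 1 + c by rewrite pdD// pd_coord Q1.
exists X, Y; split.
- split=> //; rewrite pX0 pX1 ?pY0 ?pY1; apply/funext => x; rewrite !fctE.
    by ring.
  by apply: (lincomb1 (-1) (detE det1 x)); ring.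
- move=> x v; rewrite /X /Y !fctE !mxE.
  pose D := cst (v 0 0) * P + cst (v 0 1) * Q.
  have sD : smooth D by rewrite /D.
  have [t _ Et] := MVT_line x (fun y => is_derive_pd y v sD).
  have h : 0 <= v 0 0 * (P (x + v) - P x) + v 0 1 * (Q (x + v) - Q x).
    have -> : v 0 0 * (P (x + v) - P x) + v 0 1 * (Q (x + v) - Q x) = D (x + v) - D x.
      by rewrite /D !fctE; ring.
    rewrite Et /D !pdD// !pdM// !pd_cst P0 P1 Q0 Q1 !fctE; set y := x + _.
    have c0 := c_gt0 y; rewrite -(pmulr_rge0 _ c0).
    have := sqr_ge0 (v 0 0); have := sqr_ge0 (b y * v 0 0 + c y * v 0 1).
    have := congr1 (fun z => z * v 0 0 ^+ 2) (detE det1 y); nra.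
  (* The matrix norm of v is the maximum norm, below the Euclidean one; the cross terms of the
     expanded squares add up to twice the quantity in [h]. *)
  apply: le_trans (sq_norm_le v) _.
  have := sqr_ge0 (P (x + v) - P x); have := sqr_ge0 (Q (x + v) - Q x); nra.
- move=> x; apply: (gam_gt0 det1 c_gt0); rewrite pX0 pX1 !fctE.
  rewrite gt_eqF//; have := detE det1 x; have := c_gt0 x; lra.
Qed.

Lemma disc_coord x0 : exists xi eta : E -> R, [/\ hol xi eta,
  (xi * xi + eta * eta) x0 = 0,
  forall x, `|x - x0| ^+ 2 <= (xi * xi + eta * eta) x &
  forall x, 0 < gm xi xi x].
Proof.
have [X [Y [hXY ex g0]]] := expanding_coord.
have [sX sY _ _] := hXY.
exists (X + cst (- X x0)), (Y + cst (- Y x0)); split.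
- by apply: hol_D => //; exact: hol_cst.
- by rewrite !fctE; ring.
- move=> x; have := ex x0 (x - x0); rewrite [x0 + (x - x0)]addrC subrK !fctE; congr (_ <= _); ring.
- move=> x; have := g0 x; rewrite /gam !pdD// !pd_cst !fctE; congr (_ < _); ring.
Qed.

Lemma compact_sublevel (Z : E -> R) x0 r : continuous Z ->
  (forall x, `|x - x0| ^+ 2 <= Z x) -> compact [set x | Z x <= r].
Proof.
move=> cZ hZ; apply: bounded_closed_compact.
  exists (`|x0| + r + 1); split; first exact: num_real.
  move=> e re y /= yr; apply: le_trans (ltW re).
  have h1 := le_trans (hZ y) yr.
  have h2 : `|y - x0| <= r + 1.
    have := sqr_ge0 (`|y - x0| - 1); rewrite -subr_ge0; nra.
  rewrite -[y](subrK x0) (le_trans (ler_normD _ _))//; lra.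
rewrite (_ : [set _ | _] = Z @^-1` [set z | z <= r])//.
by apply: preimage_closed; [move=> y _; exact: cZ|exact: closed_le].
Qed.

Lemma disc_gt0 (Z : E -> R) x0 x : (forall x, `|x - x0| ^+ 2 <= Z x) ->
  x != x0 -> 0 < Z x.
Proof.
by move=> hZ xx0; apply: lt_le_trans (hZ x); rewrite exprn_gt0// normr_gt0 subr_eq0.
Qed.

Lemma sq_increment_le (s : E -> R) x0 : smooth s ->
  exists2 C, 0 <= C & forall x, `|x - x0| <= 1 ->
    (s x - s x0) ^+ 2 <= C * `|x - x0| ^+ 2.
Proof.
move=> ss.
have r0 : 0 <= `|x0| + 1 by rewrite addr_ge0.
have [M0 M00 H0] := bounded_on_norm_le (smooth_continuous (smooth_pd 0 ss)) r0.
have [M1 M10 H1] := bounded_on_norm_le (smooth_continuous (smooth_pd 1 ss)) r0.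
exists ((M0 + M1) ^+ 2); first exact: sqr_ge0.
move=> x x1; have [t /andP[t0 t1]] := MVT_line x0 (fun y => is_derive_pd y (x - x0) ss).
rewrite [x0 + (x - x0)]addrC subrK => ->; set v := x - x0 in x1 *.
have yr : `|x0 + t *: v| <= `|x0| + 1.
  rewrite (le_trans (ler_normD _ _))// lerD2l normrZ gtr0_norm// -[leRHS]mulr1.
  by rewrite ler_pM// ltW.
rewrite -exprMn -real_normK ?num_real// ler_sqr ?nnegrE ?mulr_ge0 ?addr_ge0//.
rewrite !fctE (le_trans (ler_normD _ _))// mulrDl !normrM.
by rewrite lerD// mulrC ler_pM// ?H0 ?H1 ?entry_le_norm.
Qed.

(** With F = s + i t, the square (F - F(x0))^2 vanishes to second order at x0, so its squared
    modulus is o(Z), whereas that of F - F(x0) is only O(Z). On Z <= r the comparison bounds it by K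
    Z / r, which tends to 0 as r grows. The factor 4 in K = (4 M)^2 comes from |F - F(x0)|^2 <= 2
    |F|^2 + 2 |F(x0)|^2. *)
Lemma bounded_hol_const s t M : hol s t -> (forall x, s x ^+ 2 + t x ^+ 2 <= M) ->
  forall x x0, s x = s x0 /\ t x = t x0.
Proof.
move=> h bd x x0; have [ss st _ _] := h.
have [xi [eta [hZ Z0 Zx g0]]] := disc_coord x0.
pose S := s + cst (- s x0); pose T := t + cst (- t x0).
have hST : hol S T by apply: hol_D => //; exact: hol_cst.
have hS2 := hol_M det1 hST hST.
set n := S * S + T * T.
have n2 y : ((S * S - T * T) * (S * S - T * T) + (S * T + T * S) * (S * T + T * S)) y = n y ^+ 2.
  by rewrite /n !fctE; ring.
set Z := xi * xi + eta * eta in Z0 Zx.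
have cZ : continuous Z by have [? ? _ _] := hZ; apply: smooth_continuous; rewrite /Z.
have nE y : n y = (s y - s x0) ^+ 2 + (t y - t x0) ^+ 2.
  by rewrite /n /S /T !fctE; ring.
have n0 y : 0 <= n y by rewrite nE addr_ge0// sqr_ge0.
have nM y : n y ^+ 2 <= (4 * M) ^+ 2.
  have h1 := bd y; have h2 := bd x0.
  have M0 : 0 <= M by apply: le_trans h1; rewrite addr_ge0// sqr_ge0.
  rewrite ler_sqr ?nnegrE ?mulr_ge0// nE.
  have := sqr_ge0 (s y + s x0); have := sqr_ge0 (t y + t x0); nra.
have [C1 C10 H1] := sq_increment_le x0 ss.
have [C2 C20 H2] := sq_increment_le x0 st.
have small e : 0 < e -> \forall y \near x0, n y ^+ 2 <= e * Z y.
  move=> e0; near=> y.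
  have y1 : `|y - x0| <= 1.
    by rewrite distrC; near: y; apply: cvgr_dist_le => //; exact: cvg_id.
  have Zy0 : 0 <= Z y by apply: le_trans (Zx y); exact: sqr_ge0.
  have h1 : n y <= (C1 + C2) * Z y.
    rewrite nE mulrDl; apply: lerD.
      by apply: le_trans (H1 _ y1) _; rewrite ler_wpM2l.
    by apply: le_trans (H2 _ y1) _; rewrite ler_wpM2l.
  have h2 : (C1 + C2) ^+ 2 * Z y <= e.
    have h3 : Z y <= e / ((C1 + C2) ^+ 2 + 1).
      near: y; apply: (cvgr_le (Z x0)); first exact: cZ.
      by rewrite Z0 divr_gt0// ltr_wpDl ?sqr_ge0.
    move: h3; rewrite ler_pdivlMr ?ltr_wpDl ?sqr_ge0//; nra.
  apply: (@le_trans _ _ (((C1 + C2) * Z y) ^+ 2)).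
    by rewrite ler_sqr ?nnegrE ?n0// mulr_ge0// addr_ge0.
  rewrite exprMn expr2 [Z y ^+ 2]expr2 mulrA; rewrite expr2 in h2.
  exact: ler_wpM2r.
suff nx : n x = 0.
  move: nx; rewrite nE => /eqP; rewrite paddr_eq0 ?sqr_ge0// !sqrf_eq0 !subr_eq0.
  by move=> /andP[/eqP -> /eqP ->].
apply/eqP; rewrite eq_le n0 andbT leNgt; apply/negP => nx.
have Zx0 : 0 <= Z x by apply: le_trans (Zx x); exact: sqr_ge0.
pose K := (4 * M) ^+ 2; have K0 : 0 <= K by exact: sqr_ge0.
have n20 : 0 < n x ^+ 2 by rewrite exprn_gt0.
(* Large enough that n x ^+ 2 * r exceeds K * Z x, and that x lies in the disc. *)
pose r := Z x + K * Z x / n x ^+ 2 + 1.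
have r1 : Z x + 1 <= r by rewrite /r lerD2r lerDl divr_ge0 ?(ltW n20)// mulr_ge0.
have r0 : 0 < r by apply: lt_le_trans r1; rewrite ltr_wpDl.
have := @quotient_max _ a b c sa sb sc det1 closed_ab closed_bc c_gt0 _ _ _ _ x0 r K hS2 hZ Z0.
move=> /(_ (fun x => disc_gt0 Zx)) /(_ (fun x _ => g0 x) r0 (compact_sublevel cZ Zx)).
have smn e : 0 < e -> \forall y \near x0,
    ((S * S - T * T) * (S * S - T * T) + (S * T + T * S) * (S * T + T * S)) y <= e * Z y.
  by move=> e0; near=> y; rewrite n2; near: y; exact: small.
move=> /(_ smn) H.
have : n x ^+ 2 <= K / r * Z x.
  by rewrite -n2; apply: H => [y _|]; [rewrite n2; exact: nM|apply: le_trans r1; rewrite lerDl].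
rewrite mulrAC ler_pdivlMr// leNgt => /negP; apply.
have -> : n x ^+ 2 * r = n x ^+ 2 * Z x + K * Z x + n x ^+ 2.
  by rewrite /r; field; rewrite gt_eqF.
by rewrite ltr_pwDr// lerDr mulr_ge0// ltW.
Unshelve. all: by end_near. Qed.

(** If Re F <= M, then M + 1 - F has real part at least 1 and its inverse has modulus at most 1.
    Liouville makes the inverse constant, and inverting again recovers F. *)
Lemma hol_bounded_above s t M : hol s t -> (forall x, s x <= M) ->
  forall x x0, s x = s x0 /\ t x = t x0.
Proof.
move=> h bd x x0.
have hu : hol (cst (M + 1) + - s) (cst 0 + - t).
  by apply: hol_D; [exact: hol_cst|exact: hol_N].
set u := cst (M + 1) + - s in hu; set v := cst 0 + - t in hu.
have u1 y : 1 <= u y by rewrite /u !fctE; have := bd y; lra.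
pose n := u * u + v * v.
have n1 y : 1 <= n y.
  by rewrite /n !fctE; have := u1 y; have := sqr_ge0 (v y); nra.
have n0 y : n y != 0 by rewrite gt_eqF//; apply: lt_le_trans (n1 y).
have hi := hol_inv hu n0; rewrite -/n in hi.
have bi y : (u * finv n) y ^+ 2 + (- (v * finv n)) y ^+ 2 <= 1.
  rewrite !fctE finvE (_ : _ + _ = (n y)^-1); first by rewrite invf_le1 ?n1// (lt_le_trans ltr01).
  by rewrite /n !fctE; field; have := n0 y; rewrite /n !fctE.
have [E1 E2] := bounded_hol_const hi bi x x0.
have rec y : u y = (u * finv n) y / ((u * finv n) y ^+ 2 + (- (v * finv n)) y ^+ 2)
   /\ v y = - (- (v * finv n)) y / ((u * finv n) y ^+ 2 + (- (v * finv n)) y ^+ 2).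
  have -> : (u * finv n) y ^+ 2 + (- (v * finv n)) y ^+ 2 = (n y)^-1.
    by rewrite !fctE finvE /n !fctE; field; have := n0 y; rewrite /n !fctE.
  by rewrite !fctE finvE opprK !mulfK// invr_eq0.
have [ux vx] := rec x; have [ux0 vx0] := rec x0.
have : u x = u x0 by rewrite ux ux0 E1 E2.
have : v x = v x0 by rewrite vx vx0 E1 E2.
by rewrite /u /v !fctE => e1 e2; split; lra.
Qed.

(** Powers of Lewy's coordinate centred at x0, by repeated squaring; exponents 2^k are high enough
    for unique continuation. *)
Lemma disc_coord_pow x0 : exists Z : E -> R,
  [/\ smooth Z, Z x0 = 0, (forall x, `|x - x0| ^+ 2 <= Z x) &
   forall k, exists xi eta : E -> R, [/\ hol xi eta,
    forall x, (xi * xi + eta * eta) x = Z x ^+ (2 ^ k) &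
    forall x, x != x0 -> 0 < gm xi xi x]].
Proof.
have [xi [eta [hZ Z0 Zx g0]]] := disc_coord x0.
have sZ : smooth (xi * xi + eta * eta) by have [? ? _ _] := hZ.
exists (xi * xi + eta * eta); split=> //.
elim=> [|k [xi' [eta' [h' Zk gk]]]]; first by exists xi, eta; split=> // x.
exists (xi' * xi' - eta' * eta'), (xi' * eta' + eta' * xi'); split=> //.
- exact: hol_M.
- by move=> x; rewrite expnSr exprM -Zk !fctE; ring.
- move=> x xx0; rewrite (gam_sq det1 h') fctE Zk mulr_gt0//.
    by rewrite exprn_gt0//; exact: disc_gt0 xx0.
  by have := gk _ xx0; rewrite !fctE; lra.
Qed.

(** N vanishes near x0, hence to every order, and may be compared with each power of Z on the disc Z
    <= 2 Z x. There N x <= (max N) / 2^(2^k) for all k, so N x = 0. *)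
Lemma hol_unique s t (x0 : E) : hol s t ->
  (\forall y \near x0, s y = 0 /\ t y = 0) ->
  forall x, s x = 0 /\ t x = 0.
Proof.
move=> h near0 x; have [ss st _ _] := h.
have [->|xx0] := eqVneq x x0; first exact: nbhs_singleton near0.
pose N := s * s + t * t.
have NE y : N y = s y ^+ 2 + t y ^+ 2 by rewrite /N !fctE !expr2.
have N0 y : 0 <= N y by rewrite NE addr_ge0// sqr_ge0.
suff Nx : N x = 0.
  move: Nx; rewrite NE => /eqP; rewrite paddr_eq0 ?sqr_ge0// !sqrf_eq0.
  by move=> /andP[/eqP -> /eqP ->].
have [Z [sZ Z0 Zge pow]] := disc_coord_pow x0.
have cZ := smooth_continuous sZ.
have zx := disc_gt0 Zge xx0.
have cpt := @compact_sublevel _ _ (2 * Z x) cZ Zge.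
have [||y0 _ Hy0] := @EVT_max_rV R 2 N _ _ cpt.
- by exists x => /=; lra.
- by apply: continuous_subspaceT; apply: smooth_continuous; rewrite /N.
have Zge0 y : 0 <= Z y by apply: le_trans (Zge y); exact: sqr_ge0.
have z2 : 0 < 2 * Z x by rewrite mulr_gt0.
have decay k : N x * 2 ^+ (2 ^ k) <= N y0.
  have [xi [eta [hk Zk gk]]] := pow k.
  have m0 : (0 < 2 ^ k)%N by rewrite expn_gt0.
  have sub y : ((xi * xi + eta * eta) y <= (2 * Z x) ^+ (2 ^ k)) = (Z y <= 2 * Z x).
    by rewrite Zk ler_pXn2r ?nnegrE ?(ltW z2).
  have rk : 0 < (2 * Z x) ^+ (2 ^ k) by rewrite exprn_gt0.
  have H := @quotient_max _ a b c sa sb sc det1 closed_ab closed_bc c_gt0 s t xi eta x0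
    ((2 * Z x) ^+ (2 ^ k)) (N y0) h hk.
  have : N x <= N y0 / (2 * Z x) ^+ (2 ^ k) * (xi * xi + eta * eta) x.
    apply: H => //.
    - by rewrite Zk Z0 expr0n gtn_eqF.
    - by move=> y yx0; rewrite Zk exprn_gt0//; exact: disc_gt0 yx0.
    - rewrite (_ : [set _ | _] = [set y | Z y <= 2 * Z x])//.
      by apply/funext => y; rewrite /= sub.
    - move=> e e0; near=> y.
      have [sy ty] : s y = 0 /\ t y = 0 by near: y.
      by rewrite Zk !fctE sy ty !mulr0 addr0 mulr_ge0 ?(ltW e0)// exprn_ge0.
    - by move=> y; rewrite sub => yr; apply: Hy0; rewrite inE.
    - by rewrite sub; lra.
  rewrite Zk exprMn mulrAC ler_pdivlMr ?mulr_gt0 ?exprn_gt0// mulrA.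
  by rewrite ler_pM2r// exprn_gt0.
apply/eqP; rewrite eq_le N0 andbT leNgt; apply/negP => Nx.
pose k := Num.bound (N y0 / N x).
have := decay k; rewrite leNgt => /negP; apply.
have Ny0 : 0 <= N y0 / N x by rewrite divr_ge0.
rewrite -ltr_pdivrMl// mulrC.
apply: (lt_le_trans (archi_boundP Ny0)).
rewrite -natrX ler_nat; apply: leq_trans (ltnW (ltn_expl _ _)) => //.
exact: ltnW (ltn_expl _ _).
Unshelve. all: by end_near. Qed.
End Liouville.

(** * The stationary equation in null coordinates *)

Section MeanCurvature.
Variable R : realType.
Local Notation E := 'rV[R]_2.

Lemma minkDl n (u v w : 'rV[R]_n) : mink (u + v) w = mink u w + mink v w.
Proof.
by rewrite /mink -big_split/=; apply: eq_bigr => i _; rewrite mxE; ring.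
Qed.

Lemma minkZl n k (u w : 'rV[R]_n) : mink (k *: u) w = k * mink u w.
Proof. by rewrite /mink mulr_sumr; apply: eq_bigr => i _; rewrite mxE; ring. Qed.

Lemma mink2 (u v : E) : mink u v = u 0 0 * v 0 0 - u 0 1 * v 0 1.
Proof. by rewrite /mink sum_ord2 /= expr0 expr1 mul1r mulN1r. Qed.

Lemma normal_partD m (f : E -> 'rV[R]_m) x V V' :
  normal_part f x (V + V') = normal_part f x V + normal_part f x V'.
Proof.
rewrite /normal_part addrACA -opprD -big_split; congr (_ - _).
apply: eq_bigr => k _; rewrite -big_split; apply: eq_bigr => l _ /=.
by rewrite minkDl mulrDr scalerDl.
Qed.

Lemma normal_partZ m (f : E -> 'rV[R]_m) x k V :
  normal_part f x (k *: V) = k *: normal_part f x V.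
Proof.
rewrite /normal_part scalerBr scaler_sumr; congr (_ - _).
apply: eq_bigr => i _; rewrite scaler_sumr; apply: eq_bigr => j _.
by rewrite minkZl scalerA mulrCA.
Qed.

Lemma partial_row_mx m (w : E) (G : E -> 'rV[R]_m) i x : differentiable G x ->
  partial i (fun y => row_mx w (G y)) x = row_mx 0 (partial i G x).
Proof.
move=> dG.
have dl b : (fun y => row_mx w (G y) 0 (lshift m b)) = cst (w 0 b).
  by apply/funext => y; rewrite row_mxEl.
have dr b : (fun y => row_mx w (G y) 0 (rshift 2 b)) = fun y => G y 0 b.
  by apply/funext => y; rewrite row_mxEr.
have dG' b := is_derive_coord b i dG.
have dF : derivable (fun y => row_mx w (G y)) x (delta_mx 0 i).
  apply/derivable_mxP => a b; rewrite (ord1 a); case: (split_ordP b) => e ->.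
    by rewrite dl; exact: derivable_cst.
  by rewrite dr; apply: ex_derive.
rewrite /partial derive_mx//; apply/rowP => b; rewrite mxE.
case: (split_ordP b) => e ->.
  by rewrite dl derive_cst row_mxEl mxE.
by rewrite dr row_mxEr derive_val.
Qed.

Lemma normal_part0 m (f : E -> 'rV[R]_m) x : normal_part f x 0 = 0.
Proof. by rewrite -(scale0r 0) normal_partZ !scale0r. Qed.

Lemma row_mx0_lin m (k1 k2 k3 k4 : R) (u v w z : 'rV[R]_m) :
  row_mx (0 : E) (k1 *: u + k2 *: v + (k3 *: w + k4 *: z)) =
  k1 *: row_mx 0 u + k2 *: row_mx 0 v + (k3 *: row_mx 0 w + k4 *: row_mx 0 z).
Proof. by rewrite !scale_row_mx !add_row_mx !scaler0 !addr0. Qed.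

(** The traced second derivative of the graph map is (0, V). If its normal part vanishes, it is a
    tangent vector T_0 X_0 + T_1 X_1, whose plane component (T_0, T_1) must be 0; hence V = 0. *)
Lemma mean_curvature_eq0 m (f : E -> 'rV[R]_m.+1) x : smooth f ->
  let g := invmx (graph_metric f x) in
  let D i j : 'rV[R]_m.+1 := partial i (partial j f) x in
  mean_curvature f x = 0 <->
  g 0 0 *: D 0 0 + g 0 1 *: D 0 1 + (g 1 0 *: D 1 0 + g 1 1 *: D 1 1) = 0.
Proof.
move=> sf g D; set V := (X in _ <-> X = 0).
have pf j : partial j (graph_map f) = fun y => row_mx (delta_mx 0 j) (partial j f y).
  apply/funext => y; apply: partial_graph_map; exact: smooth_differentiable.
have npD i j : partial i (partial j (graph_map f)) x = row_mx 0 (D i j).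
  rewrite pf partial_row_mx//; apply: smooth_differentiable; exact: smooth_partial.
have -> : mean_curvature f x = 2^-1 *: normal_part f x (row_mx 0 V).
  rewrite /mean_curvature; congr (_ *: _).
  have S (F : 'I_2 -> 'rV[R]_(2 + m.+1)) : \sum_(i < 2) F i = F 0 + F 1 := sum_ord2 F.
  apply: etrans (S _) _.
  apply: etrans; first apply: (congr2 +%R (S _) (S _)).
  have N i j : g i j *: normal_part f x (partial i (partial j (graph_map f)) x)
      = normal_part f x (g i j *: row_mx 0 (D i j)).
    by rewrite normal_partZ npD.
  apply: etrans; first apply: (congr2 +%R (congr2 +%R (N 0 0) (N 0 1)) (congr2 +%R (N 1 0) (N 1 1))).
  have -> : row_mx (0 : E) V = g 0 0 *: row_mx 0 (D 0 0) + g 0 1 *: row_mx 0 (D 0 1)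
      + (g 1 0 *: row_mx 0 (D 1 0) + g 1 1 *: row_mx 0 (D 1 1)).
    exact: row_mx0_lin.
  apply: esym; apply: etrans (normal_partD _ _ _ _) _.
  exact: (congr2 +%R (normal_partD _ _ _ _) (normal_partD _ _ _ _)).
have npE : normal_part f x (row_mx 0 V) = row_mx 0 V - \sum_(l < 2)
   (\sum_(k < 2) invmx (graph_metric f x) k l * mink V (partial k f x))
     *: row_mx (delta_mx 0 l) (partial l f x).
  rewrite /normal_part exchange_big/=; congr (_ - _); apply: eq_bigr => l _.
  rewrite scaler_suml; apply: eq_bigr => k _; rewrite !pf mink_row_mx big1 ?add0r// => e _.
  by rewrite mxE mul0r.
split=> [H|->]; last first.
  by rewrite row_mx0 normal_part0 scaler0.
have {H} : normal_part f x (row_mx 0 V) = 0.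
  by apply/eqP; move/eqP: H; rewrite scaler_eq0 invr_eq0 pnatr_eq0.
rewrite npE [X in _ - X]sum_ord2; set T0 := (X in X *: row_mx (delta_mx 0 0) _).
set T1 := (X in X *: row_mx (delta_mx 0 1) _); clearbody T0 T1.
rewrite !scale_row_mx !add_row_mx opp_row_mx add_row_mx => H.
have Hl : 0 - (T0 *: delta_mx 0 0 + T1 *: delta_mx 0 1) = 0 :> E.
  by have := congr1 lsubmx H; rewrite row_mxKl linear0.
have h0 : T0 = 0.
  by have := congr1 (fun M : E => M 0 0) Hl; rewrite !mxE /= => h; lra.
have h1 : T1 = 0.
  by have := congr1 (fun M : E => M 0 1) Hl; rewrite !mxE /= => h; lra.
have := congr1 rsubmx H.
by rewrite row_mxKr h0 h1 !scale0r addr0 subr0 linear0.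
Qed.

Lemma invmx2 (A : 'M[R]_2) : \det A != 0 ->
  [/\ invmx A 0 0 = A 1 1 / \det A, invmx A 0 1 = - A 0 1 / \det A,
      invmx A 1 0 = - A 1 0 / \det A & invmx A 1 1 = A 0 0 / \det A].
Proof.
move=> d0.
have uA : A \in unitmx by rewrite unitmxE unitfE.
rewrite /invmx uA !mxE /cofactor !det_mx11 !mxE /=.
have l00 : lift (0 : 'I_2) (0 : 'I_1) = 1 by exact/val_inj.
have l10 : lift (1 : 'I_2) (0 : 'I_1) = 0 by exact/val_inj.
rewrite !l00 !l10 /= addn0 add0n expr0 expr1 !mul1r !mulN1r.
by rewrite -signr_odd/= expr0 mul1r; split; rewrite mulrC.
Qed.

Lemma det2 (A : 'M[R]_2) : \det A = A 0 0 * A 1 1 - A 0 1 * A 1 0.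
Proof.
have l00 : lift (0 : 'I_2) (0 : 'I_1) = 1 by exact/val_inj.
have l10 : lift (1 : 'I_2) (0 : 'I_1) = 0 by exact/val_inj.
rewrite (expand_det_row _ 0) sum_ord2 /cofactor !det_mx11 !mxE l00 l10.
by rewrite expr0 expr1 mul1r mulN1r mulrN.
Qed.

Variable f : E -> E.
Hypothesis sf : smooth f.

Definition nullp (x : E) : R := f x 0 0 + f x 0 1.
Definition nullm (x : E) : R := f x 0 0 - f x 0 1.

Lemma smooth_f_coord j : smooth (fun x => f x 0 j).
Proof. by move=> k; apply: class_C_coord; exact: sf. Qed.

Lemma smooth_nullp : smooth nullp.
Proof. exact: smoothD (smooth_f_coord 0) (smooth_f_coord 1). Qed.

Lemma smooth_nullm : smooth nullm.
Proof. exact: smoothD (smooth_f_coord 0) (smoothN (smooth_f_coord 1)). Qed.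

Lemma pd_f_coord i j x : pd i (fun x => f x 0 j) x = partial i f x 0 j.
Proof. by rewrite pdE partial_coord//; exact: smooth_differentiable. Qed.

Lemma pd_nullp i x : pd i nullp x = partial i f x 0 0 + partial i f x 0 1.
Proof.
rewrite -!pd_f_coord -[nullp]/((fun x => f x 0 0) + (fun x => f x 0 1)) pdD//; exact: smooth_f_coord.
Qed.

Lemma pd_nullm i x : pd i nullm x = partial i f x 0 0 - partial i f x 0 1.
Proof.
rewrite -!pd_f_coord -[nullm]/((fun x => f x 0 0) - (fun x => f x 0 1)) pdB//; exact: smooth_f_coord.
Qed.

Lemma graph_metric_null x i j : graph_metric f x i j =
  (i == j)%:R + (pd i nullp x * pd j nullm x + pd i nullm x * pd j nullp x) / 2.
Proof.
have polar (a b c d : R) :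
    a * c - b * d = ((a + b) * (c - d) + (a - b) * (c + d)) / 2 by field.
by rewrite !pd_nullp !pd_nullm mxE mink2; congr (_ + _); exact: polar.
Qed.
End MeanCurvature.

(** What the classification retains of the graph: its metric is W times (a b; b c), and its
    coordinates are harmonic, x_0 and x_1 through the closedness fields, p and m through the last
    two. *)
Record conformal_structure (R : realType) (p m W a b c : 'rV[R]_2 -> R) : Prop := {
  cs_smooth_p : smooth p;
  cs_smooth_m : smooth m;
  cs_smooth_a : smooth a;
  cs_smooth_b : smooth b;
  cs_smooth_c : smooth c;
  cs_W_gt0 : forall x, 0 < W x;
  cs_aW : a * W = cst 1 + pd 0 p * pd 0 m;
  cs_bW : b * W = cst 2^-1 * (pd 0 p * pd 1 m + pd 0 m * pd 1 p);
  cs_cW : c * W = cst 1 + pd 1 p * pd 1 m;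
  cs_det : a * c - b * b = 1;
  cs_closed_ab : pd 1 a = pd 0 b;
  cs_closed_bc : pd 1 b = pd 0 c;
  cs_c_gt0 : forall x, 0 < c x;
  cs_lap_p : lap a b c p = 0;
  cs_lap_m : lap a b c m = 0 }.

(** * From vanishing mean curvature to the conformal structure *)

Section Stationary.
Variable R : realType.
Local Notation E := 'rV[R]_2.

Lemma pd_inv_sqrt i (V D : E -> R) : smooth V -> smooth D -> V * V * D = 1 ->
  pd i V = - (cst 2^-1 * V * V * V * pd i D).
Proof.
move=> sV sD VD; have VDc : V * V * D = cst 1 by exact: VD.
have := congr1 (pd i) VDc; rewrite pd_cst !pdM//.
move=> H; apply/funext => x; have h1 : V x * V x * D x = 1 := congr1 (@^~ x) VD.
have := congr1 (@^~ x) H; rewrite !fctE => h2.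
by apply: (lincomb2 (- pd i V x) (V x / 2) h1 h2); field.
Qed.

(** The equations for p and m say that the trace g^{ij} X_ij vanishes. Its tangential components are
    the contracted Christoffel symbols, and their vanishing is the harmonicity of x_0 and x_1. *)
Lemma closed_identities (p m V : E -> R) :
  smooth p -> smooth m -> smooth V ->
  let g00 := cst 1 + pd 0 p * pd 0 m in
  let g11 := cst 1 + pd 1 p * pd 1 m in
  let g01 := cst 2^-1 * (pd 0 p * pd 1 m + pd 0 m * pd 1 p) in
  let D := g00 * g11 - g01 * g01 in
  V * V * D = 1 ->
  (forall F, F = p \/ F = m ->
    g11 * pd 0 (pd 0 F) - cst 2 * g01 * pd 0 (pd 1 F) + g00 * pd 1 (pd 1 F) = 0) ->
  pd 1 (g00 * V) = pd 0 (g01 * V) /\ pd 1 (g01 * V) = pd 0 (g11 * V).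
Proof.
move=> sp sm sV g00 g11 g01 D VD L.
have LP := L p (or_introl erefl); have LM := L m (or_intror erefl).
have s00 : smooth g00 by rewrite /g00.
have s01 : smooth g01 by rewrite /g01.
have s11 : smooth g11 by rewrite /g11.
have sD : smooth D by rewrite /D.
have pV i := pd_inv_sqrt i sV sD VD.
have p00 i : pd i g00 = pd 0 p * pd i (pd 0 m) + pd 0 m * pd i (pd 0 p).
  by rewrite pdD ?pdM// pd_cst; apply/funext => x; rewrite !fctE add0r.
have p11 i : pd i g11 = pd 1 p * pd i (pd 1 m) + pd 1 m * pd i (pd 1 p).
  by rewrite pdD ?pdM// pd_cst; apply/funext => x; rewrite !fctE add0r.
have p01 i : pd i g01 = cst 2^-1 * (pd 0 p * pd i (pd 1 m) + pd 1 m * pd i (pd 0 p)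
    + (pd 0 m * pd i (pd 1 p) + pd 1 p * pd i (pd 0 m))).
  by rewrite pdM// pdD ?pdM// pd_cst; apply/funext => x; rewrite !fctE mulr0 addr0.
have pD i : pd i D = g00 * pd i g11 + g11 * pd i g00 - (g01 * pd i g01 + g01 * pd i g01).
  by rewrite pdB// ?pdM//; apply: smoothM.
have C (p' : E -> R) : smooth p' -> pd 1 (pd 0 p') = pd 0 (pd 1 p') by exact: pdC.
have DE x : D x = g00 x * g11 x - g01 x * g01 x by [].
have E00 x : g00 x = 1 + pd 0 p x * pd 0 m x by [].
have E11 x : g11 x = 1 + pd 1 p x * pd 1 m x by [].
have E01 x : g01 x = 2^-1 * (pd 0 p x * pd 1 m x + pd 0 m x * pd 1 p x) by [].
clearbody D g00 g11 g01.
split; rewrite !pdM// !pV; apply/funext => x.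
  have h0 : V x * V x * D x = 1 := congr1 (@^~ x) VD.
  have hP : _ = (0 : R) := congr1 (@^~ x) LP.
  have hM : _ = (0 : R) := congr1 (@^~ x) LM.
  move: h0 hP hM; rewrite !pD !p00 !p11 !p01 !(C p sp) !(C m sm) !fctE !DE !E00 !E11 !E01 => h0 hP hM.
  pose A := pd 1 p x * pd 0 m x.
  (* The coefficients of [hP] and [hM] pair the equations, in the null form of the Minkowski
     product, with the tangent vector g00 X_1 - g01 X_0; the coefficient of [h0] trades V for V^3 D.
     The second identity uses g11 X_0 - g01 X_1. *)
  apply: (lincomb3 (- V x * (pd 0 p x * pd 0 (pd 1 m) x + pd 0 m x * pd 0 (pd 1 p) x
    - 2^-1 * (pd 0 p x * pd 0 (pd 1 m) x + pd 1 m x * pd 0 (pd 0 p) x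
    + (pd 0 m x * pd 0 (pd 1 p) x + pd 1 p x * pd 0 (pd 0 m) x))))
   (- 2^-1 * V x ^+ 3 *
     ((1 + pd 0 p x * pd 0 m x) * pd 1 m x - 2^-1 * (pd 0 p x * pd 1 m x + pd 0 m x * pd 1 p x) * pd 0 m x))
   (- 2^-1 * V x ^+ 3 *
     ((1 + pd 0 p x * pd 0 m x) * pd 1 p x - 2^-1 * (pd 0 p x * pd 1 m x + pd 0 m x * pd 1 p x) * pd 0 p x))
   h0 hP hM).
  move: (V x) (pd 0 p x) (pd 1 p x) (pd 0 m x) (pd 1 m x).
  generalize (pd 0 (pd 0 p) x) (pd 0 (pd 1 p) x) (pd 1 (pd 1 p) x)
    (pd 0 (pd 0 m) x) (pd 0 (pd 1 m) x) (pd 1 (pd 1 m) x).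
  by move=> *; field.
have h0 : V x * V x * D x = 1 := congr1 (@^~ x) VD.
have hP : _ = (0 : R) := congr1 (@^~ x) LP.
have hM : _ = (0 : R) := congr1 (@^~ x) LM.
move: h0 hP hM; rewrite !pD !p00 !p11 !p01 !(C p sp) !(C m sm) !fctE !DE !E00 !E11 !E01 => h0 hP hM.
apply: (lincomb3 (- V x * (2^-1 * (pd 0 p x * pd 1 (pd 1 m) x + pd 1 m x * pd 0 (pd 1 p) x
    + (pd 0 m x * pd 1 (pd 1 p) x + pd 1 p x * pd 0 (pd 1 m) x))
    - (pd 1 p x * pd 0 (pd 1 m) x + pd 1 m x * pd 0 (pd 1 p) x)))
   (2^-1 * V x ^+ 3 *
     ((1 + pd 1 p x * pd 1 m x) * pd 0 m x - 2^-1 * (pd 0 p x * pd 1 m x + pd 0 m x * pd 1 p x) * pd 1 m x))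
   (2^-1 * V x ^+ 3 *
     ((1 + pd 1 p x * pd 1 m x) * pd 0 p x - 2^-1 * (pd 0 p x * pd 1 m x + pd 0 m x * pd 1 p x) * pd 1 p x))
   h0 hP hM).
move: (V x) (pd 0 p x) (pd 1 p x) (pd 0 m x) (pd 1 m x).
generalize (pd 0 (pd 0 p) x) (pd 0 (pd 1 p) x) (pd 1 (pd 1 p) x)
  (pd 0 (pd 0 m) x) (pd 0 (pd 1 m) x) (pd 1 (pd 1 m) x).
by move=> *; field.
Qed.

Variable f : E -> E.
Hypothesis sf : smooth f.
Local Notation p := (nullp f).
Local Notation m := (nullm f).
Local Notation g := (graph_metric f).

Lemma graph_metric_sym x : g x 1 0 = g x 0 1.
Proof. rewrite !graph_metric_null//; congr (_ + _ / 2).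
by rewrite addrC; congr (_ + _); exact: mulrC. Qed.

Lemma quadE (A : 'M[R]_2) (v : E) : (v *m A *m v^T) 0 0 =
  v 0 0 ^+ 2 * A 0 0 + v 0 0 * v 0 1 * (A 0 1 + A 1 0) + v 0 1 ^+ 2 * A 1 1.
Proof. by rewrite !mxE sum_ord2 !mxE !sum_ord2; ring. Qed.

Lemma spacelike_pos : spacelike f -> forall x,
  [/\ 0 < g x 0 0, 0 < g x 1 1 & 0 < g x 0 0 * g x 1 1 - g x 0 1 ^+ 2].
Proof.
move=> sp x.
have H (s t : R) : (s != 0) || (t != 0) ->
    0 < s ^+ 2 * g x 0 0 + s * t * (2 * g x 0 1) + t ^+ 2 * g x 1 1.
  move=> st; pose v : E := s *: delta_mx 0 0 + t *: delta_mx 0 1.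
  have v0 : v 0 0 = s by rewrite !mxE/= mulr1 mulr0 addr0.
  have v1 : v 0 1 = t by rewrite !mxE/= mulr1 mulr0 add0r.
  have vn0 : v != 0.
    by apply: contraTN st => /eqP ve; rewrite -v0 -v1 ve !mxE eqxx.
  have := sp x v vn0; rewrite quadE graph_metric_sym v0 v1.
  by rewrite -mulr2n -[_ *+ 2]mulr_natl.
move: (g x 0 0) (g x 0 1) (g x 1 1) H => A B C H.
have A0 : 0 < A by have := H 1 0; rewrite oner_eq0 => /(_ isT); lra.
have C0 : 0 < C by have := H 0 1; rewrite oner_eq0 orbT => /(_ isT); lra.
split=> //; rewrite -(pmulr_rgt0 _ A0).
(* On (-B, A) the quadratic form takes the value A (A C - B^2). *)
have := H (- B) A; rewrite (gt_eqF A0) orbT => /(_ isT).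
by congr (_ < _); ring.
Qed.

Lemma pd_pd_nullp i j x : pd i (pd j p) x =
  partial i (partial j f) x 0 0 + partial i (partial j f) x 0 1.
Proof.
have -> : pd j p = nullp (partial j f) by apply/funext => y; exact: pd_nullp.
by apply: pd_nullp; exact: smooth_partial.
Qed.

Lemma pd_pd_nullm i j x : pd i (pd j m) x =
  partial i (partial j f) x 0 0 - partial i (partial j f) x 0 1.
Proof.
have -> : pd j m = nullm (partial j f) by apply/funext => y; exact: pd_nullm.
by apply: pd_nullm; exact: smooth_partial.
Qed.

Lemma mean_curvature_null x : 0 < g x 0 0 * g x 1 1 - g x 0 1 ^+ 2 ->
  mean_curvature f x = 0 <->
  forall F, F = p \/ F = m ->
    g x 1 1 * pd 0 (pd 0 F) x - 2 * g x 0 1 * pd 0 (pd 1 F) x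
      + g x 0 0 * pd 1 (pd 1 F) x = 0.
Proof.
move=> d0; set d := (X in 0 < X) in d0.
have dE : \det (g x) = d by rewrite /d det2 graph_metric_sym expr2.
have [] := @invmx2 _ (g x); first by rewrite dE gt_eqF.
rewrite dE graph_metric_sym => i00 i01 i10 i11.
have sym k : partial 1 (partial 0 f) x 0 k = partial 0 (partial 1 f) x 0 k.
  have sk := smooth_f_coord sf k.
  have e i j : pd i (pd j (fun x => f x 0 k)) x = partial i (partial j f) x 0 k.
    have -> : pd j (fun x => f x 0 k) = fun x => partial j f x 0 k.
      by apply/funext => y; exact: (pd_f_coord sf j k y).
    exact: (pd_f_coord (smooth_partial j sf) i k x).
  exact: etrans (esym (e 1 0)) (etrans (congr1 (@^~ x) (pdC 1 0 sk)) (e 0 1)).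
have key : (mean_curvature f x = 0 <-> forall k,
  g x 1 1 * partial 0 (partial 0 f) x 0 k - 2 * g x 0 1 * partial 0 (partial 1 f) x 0 k
      + g x 0 0 * partial 1 (partial 1 f) x 0 k = 0).
  have [H1 H2] := mean_curvature_eq0 x sf.
  have entry k (A B C D : E) (s t u v : R) : (s *: A + t *: B + (u *: C + v *: D)) 0 k =
     s * A 0 k + t * B 0 k + (u * C 0 k + v * D 0 k) by rewrite !mxE.
  have z k : (0 : E) 0 k = 0 by rewrite mxE.
  move: sym H1 H2 => /=; rewrite i00 i01 i10 i11.
  generalize (partial 0 (partial 0 f) x) (partial 0 (partial 1 f) x)
    (partial 1 (partial 0 f) x) (partial 1 (partial 1 f) x) => A B C D sym H1 H2.
  split=> [/H1 H k|H].
    have := congr1 (fun v : E => v 0 k) H.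
    rewrite entry z sym => h; apply: (lincomb1 d h); rewrite subr0.
    by field; rewrite gt_eqF.
  apply: H2; apply/rowP => k; rewrite entry z sym.
  apply: (lincomb1 d^-1 (H k)); rewrite !subr0.
  by field; rewrite gt_eqF.
rewrite key; split=> [H F [->|->]|H k].
- rewrite !pd_pd_nullp; have := H 0; have := H 1.
  generalize (partial 0 (partial 0 f) x 0 0) (partial 0 (partial 1 f) x 0 0) (partial 1 (partial 1 f) x 0 0)
   (partial 0 (partial 0 f) x 0 1) (partial 0 (partial 1 f) x 0 1) (partial 1 (partial 1 f) x 0 1).
  by move=> *; nra.
- rewrite !pd_pd_nullm; have := H 0; have := H 1.
  generalize (partial 0 (partial 0 f) x 0 0) (partial 0 (partial 1 f) x 0 0) (partial 1 (partial 1 f) x 0 0)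
   (partial 0 (partial 0 f) x 0 1) (partial 0 (partial 1 f) x 0 1) (partial 1 (partial 1 f) x 0 1).
  by move=> *; nra.
have := H p (or_introl erefl); have := H m (or_intror erefl).
rewrite !pd_pd_nullm !pd_pd_nullp.
have [->|->] := ord2P k;
  generalize (partial 0 (partial 0 f) x 0 0) (partial 0 (partial 1 f) x 0 0) (partial 1 (partial 1 f) x 0 0)
   (partial 0 (partial 0 f) x 0 1) (partial 0 (partial 1 f) x 0 1) (partial 1 (partial 1 f) x 0 1);
  by move=> *; nra.
Qed.

Lemma stationary_conformal : spacelike_stationary f ->
  exists a b c, conformal_structure p m (Wfun f) a b c.
Proof.
move=> [sl mc]; have pos := spacelike_pos sl.
have sp := smooth_nullp sf; have sm := smooth_nullm sf.
pose g00 := cst 1 + pd 0 p * pd 0 m.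
pose g11 := cst 1 + pd 1 p * pd 1 m.
pose g01 := cst 2^-1 * (pd 0 p * pd 1 m + pd 0 m * pd 1 p).
have e00 x : g x 0 0 = g00 x by rewrite graph_metric_null// /g00 !fctE/=; field.
have e11 x : g x 1 1 = g11 x by rewrite graph_metric_null// /g11 !fctE/=; field.
have e01 x : g x 0 1 = g01 x by rewrite graph_metric_null// /g01 !fctE/=; field.
pose D := g00 * g11 - g01 * g01.
have D0 x : 0 < D x by have [_ _] := pos x; rewrite e00 e11 e01.
have sD : smooth D by rewrite /D /g00 /g11 /g01.
have WE : Wfun f = fun x => Num.sqrt (D x).
  by apply/funext => x; rewrite /Wfun det2 graph_metric_sym e00 e11 e01.
have W0 x : 0 < Wfun f x by rewrite WE sqrtr_gt0.
have sW : smooth (Wfun f) by rewrite WE => k; apply: class_C_sqrt => //; exact: sD.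
pose V := finv (Wfun f).
have sV : smooth V by apply: smooth_finv => // x; rewrite gt_eqF.
have VW : V * Wfun f = 1 by apply/funext => x; rewrite fctE /V finvE mulVf// gt_eqF.
have WW : Wfun f * Wfun f = D.
  by apply/funext => x; rewrite !fctE WE -expr2 sqr_sqrtr// ltW.
have VD : V * V * D = 1 by rewrite -WW; apply: (lincomb1 (V * Wfun f + 1) VW); ring.
have L F : F = p \/ F = m ->
    g11 * pd 0 (pd 0 F) - cst 2 * g01 * pd 0 (pd 1 F) + g00 * pd 1 (pd 1 F) = 0.
  move=> HF; apply/funext => x; have [_ _ d0] := pos x.
  have [/(_ (mc x)) /(_ F HF)] := mean_curvature_null d0.
  by rewrite e00 e11 e01.
have [cab cbc] := closed_identities sp sm sV VD L.
have V0 x : 0 < V x by rewrite /V finvE invr_gt0.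
have lap0 F : F = p \/ F = m -> lap (g00 * V) (g01 * V) (g11 * V) F = 0.
  move=> /L HL; apply/funext => x; have h : _ = (0 : R) := congr1 (@^~ x) HL.
  move: h; rewrite /lap !fctE => h.
  by rewrite -[RHS]/(0 : R); apply: (lincomb1 (V x) h); ring.
exists (g00 * V), (g01 * V), (g11 * V); split=> //.
- by apply: smoothM => //; rewrite /g00.
- by apply: smoothM => //; rewrite /g01.
- by apply: smoothM => //; rewrite /g11.
- by rewrite -/g00 -mulrA VW mulr1.
- by rewrite -/g01 -mulrA VW mulr1.
- by rewrite -/g11 -mulrA VW mulr1.
- by rewrite -VD /D; ring.
- by move=> x; rewrite fctE mulr_gt0//; have [_ + _] := pos x; rewrite e11.
- by apply: lap0; left.
- by apply: lap0; right.
Qed.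
End Stationary.

(** * Joergens' theorem *)

Section Jorgens.
Variables (R : realType) (a b c : 'rV[R]_2 -> R).
Local Notation E := 'rV[R]_2.
Hypotheses (sa : smooth a) (sb : smooth b) (sc : smooth c).
Hypothesis det1 : a * c - b * b = 1.
Hypothesis closed_ab : pd 1 a = pd 0 b.
Hypothesis closed_bc : pd 1 b = pd 0 c.
Hypothesis c_gt0 : forall x, 0 < c x.

(** The Jacobian determinant (1 + a) (1 + c) - b^2 of Lewy's map, simplified by a c - b^2 = 1. *)
Let n := a + c + cst 2.

Lemma pd_det i x : pd i a x * c x + a x * pd i c x - 2 * b x * pd i b x = 0.
Proof.
have det1' : a * c - b * b = cst 1 by exact: det1.
have := congr1 (fun F => pd i F x) det1'.
by rewrite pdB ?pdM// pd_cst !fctE => h; apply: (lincomb1 1 h); ring.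
Qed.

Lemma trace_gt0 x : 0 < n x.
Proof.
by rewrite /n !fctE; have := a_gt0 det1 c_gt0 x; have := c_gt0 x; lra.
Qed.

(* The Beltrami coefficient of the structure, read in Lewy's coordinate, is
   holomorphic of modulus < 1. *)
Lemma hol_beltrami : hol a b c ((c - a) * finv n) ((b + b) * finv n).
Proof.
have n0 x : n x != 0 by rewrite gt_eqF// trace_gt0.
have sn : smooth n by rewrite /n.
have sV : smooth (finv n) by exact: smooth_finv.
have pn i : pd i n = pd i a + pd i c.
  rewrite /n !pdD// pd_cst; apply/funext => x; rewrite !fctE. ring.
have pV i : pd i (finv n) = - (finv n * finv n * (pd i a + pd i c)).
  by rewrite pd_finv// pn.
have nE x : n x = a x + c x + 2 by [].
split=> //; rewrite !pdM// !pV !(pdB, pdD)// ?closed_ab ?closed_bc; apply/funext => x.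
  have h0 := detE det1 x; have h1 := pd_det 0 x; have h2 := pd_det 1 x.
  rewrite closed_ab closed_bc in h2; rewrite !fctE /finv.
  apply: (lincomb3 (- 4 * pd 0 b x / n x ^+ 2) (2 * b x / n x ^+ 2)
      (2 * (a x + 1) / n x ^+ 2) h0 h1 h2).
  by rewrite nE; field; rewrite -nE.
have h0 := detE det1 x; have h1 := pd_det 0 x; have h2 := pd_det 1 x.
rewrite closed_ab closed_bc in h2; rewrite !fctE /finv.
apply: (lincomb3 (- 4 * pd 0 c x / n x ^+ 2) (2 * (c x + 1) / n x ^+ 2)
    (2 * b x / n x ^+ 2) h0 h1 h2).
by rewrite nE; field; rewrite -nE.
Qed.

(** Determinant 1 gives (c - a)^2 + 4 b^2 = (a + c)^2 - 4 = n (n - 4). The formula both bounds the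
    coefficient and lets n, hence a, b and c, be recovered from it. *)
Lemma beltrami_norm x :
  ((c - a) * finv n) x ^+ 2 + ((b + b) * finv n) x ^+ 2 = 1 - 4 / n x.
Proof.
have n0 : n x != 0 by rewrite gt_eqF// trace_gt0.
have nE : n x = a x + c x + 2 by [].
rewrite !fctE /finv; have h0 := detE det1 x.
apply: (lincomb1 (- 4 / n x ^+ 2) h0).
by rewrite nE; field; rewrite -nE.
Qed.

Lemma jorgens x x0 : [/\ a x = a x0, b x = b x0 & c x = c x0].
Proof.
have [|E1 E2] := bounded_hol_const sa sb sc det1 closed_ab closed_bc c_gt0
  (M := 1) hol_beltrami _ x x0.
  move=> y; rewrite beltrami_norm gerBl divr_ge0// ltW//; exact: trace_gt0.
have := beltrami_norm x; rewrite E1 E2 beltrami_norm => E3.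
have nx := trace_gt0 x; have nx0 := trace_gt0 x0.
have E4 : n x = n x0.
  apply: invr_inj; have : 4 / n x0 = 4 / n x by lra.
  by move=> h; lra.
move: E1 E2; rewrite !fctE /finv E4.
have nI : (n x0)^-1 != 0 by rewrite invr_eq0 gt_eqF.
move=> /(mulIf nI) E5 /(mulIf nI) E6.
have : a x + c x + 2 = a x0 + c x0 + 2 := E4.
by move=> E7; split; lra.
Qed.
End Jorgens.

(** * Arguments of holomorphic pairs *)

Section Trigonometric.
Variable R : realType.
Local Notation E := 'rV[R]_2.

Lemma const_of_pd0 (F : E -> R) : smooth F -> (forall i x, pd i F x = 0) ->
  forall x y, F x = F y.
Proof.
move=> sF F0 x y; have [t _] := MVT_line y (fun z => is_derive_pd z (x - y) sF).
rewrite [y + (x - y)]addrC subrK !fctE !F0 !mulr0 addr0 => /eqP.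
by rewrite subr_eq0 => /eqP.
Qed.

Lemma partial_comp1 i (phi dphi : R -> R) (F : E -> R) :
  (forall z : R, is_derive z 1 phi (dphi z)) -> (forall x, differentiable F x) ->
  (forall x, differentiable (phi \o F) x) /\
  partial i (phi \o F) = (dphi \o F) * partial i F.
Proof.
move=> dphi' dF.
have ds z : differentiable phi z by apply/derivable1_diffP; apply: ex_derive.
have dc x : differentiable (phi \o F) x by apply: differentiable_comp.
split=> //; apply/funext => x; rewrite /partial.
rewrite deriveE//; rewrite (@diff_comp _ _ _ _ F phi)//=.
rewrite deriv1E; last exact/derivable1_diffP.
rewrite -deriveE// derive1E derive_val !fctE /=; exact: mulrC.
Qed.

Lemma class_C_cos_sin k (F : E -> R) : class_C k F ->
  class_C k (cos \o F) /\ class_C k (sin \o F).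
Proof.
have dcos (z : R) : is_derive z 1 cos (- sin z) := is_derive_cos z.
have dsin (z : R) : is_derive z 1 sin (cos z) := is_derive_sin z.
elim: k F => [|k IH] F.
  move=> cF; split=> x; apply: continuous_comp; do ?exact: cF.
    exact: continuous_cos.
  exact: continuous_sin.
move=> cF; have [dF pF] := cF; have [IHc IHs] := IH _ (class_C_S cF).
split; split=> [x|i].
- exact: (partial_comp1 0 dcos dF).1.
- rewrite (partial_comp1 i dcos dF).2; apply: class_CM; last exact: pF.
  rewrite (_ : _ \o F = cst (-1) * (sin \o F)).
    by apply: class_CM => //; exact: class_C_cst.
  by apply/funext => x; rewrite !fctE /= mulN1r.
- exact: (partial_comp1 0 dsin dF).1.
- by rewrite (partial_comp1 i dsin dF).2; apply: class_CM => //; exact: pF.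
Qed.

Lemma smooth_cos (F : E -> R) : smooth F -> smooth (cos \o F).
Proof. by move=> sF k; have [] := class_C_cos_sin (sF k). Qed.

Lemma smooth_sin (F : E -> R) : smooth F -> smooth (sin \o F).
Proof. by move=> sF k; have [] := class_C_cos_sin (sF k). Qed.

Lemma pd_cos i (F : E -> R) : smooth F -> pd i (cos \o F) = - (sin \o F) * pd i F.
Proof.
move=> sF; rewrite !pdE; have dF x := smooth_differentiable x sF.
have dcos (z : R) : is_derive z 1 cos (- sin z) := is_derive_cos z.
by rewrite (partial_comp1 i dcos dF).2.
Qed.

Lemma pd_sin i (F : E -> R) : smooth F -> pd i (sin \o F) = (cos \o F) * pd i F.
Proof.
move=> sF; rewrite !pdE; have dF x := smooth_differentiable x sF.
have dsin (z : R) : is_derive z 1 sin (cos z) := is_derive_sin z.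
by rewrite (partial_comp1 i dsin dF).2.
Qed.

Lemma cos_sin_attains (P Q r y : R) : 0 < r -> P ^+ 2 + Q ^+ 2 = r ^+ 2 ->
  -r <= y <= r -> exists tau, P * cos tau + Q * sin tau = y.
Proof.
move=> r0 PQ /andP[ry yr].
have acosE (z : R) : - r <= z <= r -> exists t, cos t = z / r.
  move=> /andP[z0 z1]; exists (acos (z / r)); apply: acosK.
  by rewrite in_itv/= ler_pdivlMr// mulN1r z0 ler_pdivrMr// mul1r.
have P1 : - r <= P <= r.
  by rewrite -ler_norml -(ger0_norm (ltW r0)) -ler_sqr ?nnegrE// !real_normK ?num_real// -PQ lerDl sqr_ge0.
have [psi0 Hpsi0] := acosE _ P1.
(* Polar form of (P, Q): [acos] fixes the cosine, and passing to the opposite angle corrects the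
   sign of the sine. *)
have [psi [Hc Hs]] : exists psi, P = r * cos psi /\ Q = r * sin psi.
  have E1 : P = r * cos psi0 by rewrite Hpsi0; field; rewrite gt_eqF.
  have : Q ^+ 2 = (r * sin psi0) ^+ 2.
    have := cos2Dsin2 psi0 => h; apply: (lincomb3 1 (- (P + r * cos psi0)) (- r ^+ 2) PQ E1 h); ring.
  move/eqP; rewrite eqf_sqr => /orP[/eqP E2|/eqP E2].
    by exists psi0.
  by exists (- psi0); rewrite cosN sinN mulrN.
have [|t Ht] := acosE y; first by rewrite ry yr.
exists (t + psi); rewrite cosD sinD Hc Hs.
have := cos2Dsin2 psi => h.
by apply: (lincomb2 (r * cos t) r h Ht); field; rewrite gt_eqF.
Qed.
End Trigonometric.

Lemma pd_cstM (R : realType) i (k : R) (F : 'rV[R]_2 -> R) : smooth F ->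
  pd i (cst k * F) = cst k * pd i F.
Proof.
by move=> sF; rewrite pdM// pd_cst; apply/funext => x; rewrite !fctE; ring.
Qed.

(** * Constant conformal structures *)

Section ConstantStructure.
Variables (R : realType) (A B C : R).
Local Notation E := 'rV[R]_2.
Hypothesis C_gt0 : 0 < C.
Hypothesis ABC : A * C - B * B = 1.
Local Notation a := (cst A : E -> R).
Local Notation b := (cst B : E -> R).
Local Notation c := (cst C : E -> R).
Local Notation hol := (hol a b c).

Let det1 : a * c - b * b = 1.
Proof. by apply/funext => x; rewrite !fctE ABC. Qed.

Let closed_ab : pd 1 a = pd 0 b. Proof. by rewrite !pd_cst. Qed.
Let closed_bc : pd 1 b = pd 0 c. Proof. by rewrite !pd_cst. Qed.

(* Real and imaginary part of the complex derivative of [p]. *)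
Definition dre (p : E -> R) := pd 0 p - cst (B / C) * pd 1 p.
Definition dim (p : E -> R) := - (cst C^-1 * pd 1 p).

Lemma smooth_dre p : smooth p -> smooth (dre p).
Proof. by move=> sp; rewrite /dre. Qed.

Lemma smooth_dim p : smooth p -> smooth (dim p).
Proof. by move=> sp; rewrite /dim. Qed.

Lemma pd1_dim p x : pd 1 p x = - C * dim p x.
Proof. by rewrite /dim !fctE; field; rewrite gt_eqF. Qed.

Lemma pd0_dre p x : pd 0 p x = dre p x - B * dim p x.
Proof. by rewrite /dim /dre !fctE; field; rewrite gt_eqF. Qed.

(** In the isothermal coordinate z = u + i v with u = x_0 and v = B x_0 + C x_1, the pair is p_u - i
    p_v, the derivative of the holomorphic function with real part p. *)
Lemma hol_d p : smooth p -> lap a b c p = 0 -> hol (dre p) (dim p).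
Proof.
move=> sp L; have C0 : C != 0 by rewrite gt_eqF.
split; [exact: smooth_dre|exact: smooth_dim|..];
  rewrite /dim /dre pdN// !pdB// !pd_cstM//; apply/funext => x.
  have h : _ = (0 : R) := congr1 (@^~ x) L; move: h; rewrite /lap (pdC 1 0 sp) !fctE => h.
  by apply: (lincomb2 (pd 0 (pd 1 p) x / C) (- B / C) ABC h); field.
have h : _ = (0 : R) := congr1 (@^~ x) L; move: h; rewrite /lap (pdC 1 0 sp) !fctE => h.
by apply: (lincomb2 (pd 1 (pd 1 p) x / C) (- 1) ABC h); field.
Qed.

Lemma const_of_d0 p : smooth p -> (forall x, dre p x = 0 /\ dim p x = 0) ->
  forall x y, p x = p y.
Proof.
move=> sp d0; apply: const_of_pd0 => // i x; have [d1 d2] := d0 x.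
by have [->|->] := ord2P i; rewrite ?pd0_dre ?pd1_dim ?d1 ?d2; ring.
Qed.

Variables (p m W : E -> R).
Hypothesis cs : conformal_structure p m W a b c.
Let sp := cs_smooth_p cs.
Let sm := cs_smooth_m cs.

(** k1 + i k2 is the value of alpha beta. Conformality in z requires 1 + ((B + i) / C)^2 + alpha
    beta = 0, the first two terms being the squared derivatives of x_0 and x_1. *)
Let k1 : R := (1 - B ^+ 2) / C ^+ 2 - 1.
Let k2 : R := - 2 * B / C ^+ 2.

Lemma metric_eqs x : [/\ A * W x = 1 + pd 0 p x * pd 0 m x,
  B * W x = 2^-1 * (pd 0 p x * pd 1 m x + pd 0 m x * pd 1 p x) &
  C * W x = 1 + pd 1 p x * pd 1 m x].
Proof.
by split; [exact: (congr1 (@^~ x) (cs_aW cs))|exact: (congr1 (@^~ x) (cs_bW cs))|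
  exact: (congr1 (@^~ x) (cs_cW cs))].
Qed.

Lemma dd_re x : dre p x * dre m x - dim p x * dim m x = k1.
Proof.
have [h1 h2 h3] := metric_eqs x; have C0 : C != 0 by rewrite gt_eqF.
move: h1 h2 h3; rewrite /k1 !pd0_dre !pd1_dim.
move: (dre p x) (dim p x) (dre m x) (dim m x) (W x) => s t s' t' w h1 h2 h3.
apply: (lincomb4 (-1) (2 * B / C) ((1 - B ^+ 2) / C ^+ 2) (w / C) h1 h2 h3 ABC).
by field.
Qed.

Lemma dd_im x : dre p x * dim m x + dim p x * dre m x = k2.
Proof.
have [h1 h2 h3] := metric_eqs x; have C0 : C != 0 by rewrite gt_eqF.
move: h2 h3; rewrite /k2 !pd0_dre !pd1_dim.
move: (dre p x) (dim p x) (dre m x) (dim m x) (W x) => s t s' t' w h2 h3.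
apply: (lincomb2 (2 / C) (- 2 * B / C ^+ 2) h2 h3).
by field.
Qed.

(** The area density is C, the Jacobian of z, times half the Minkowski sum of the squared moduli of
    the complex derivatives; x_0 and x_1 contribute 1 + A / C, and f contributes Re (alpha conj
    beta). *)
Lemma W_dd x : W x = (A + C) / 2 + C / 2 * (dre p x * dre m x + dim p x * dim m x).
Proof.
have [h1 h2 h3] := metric_eqs x; have C0 : C != 0 by rewrite gt_eqF.
move: h1 h2 h3; rewrite !pd0_dre !pd1_dim.
move: (dre p x) (dim p x) (dre m x) (dim m x) (W x) => s t s' t' w h1 h2 h3.
apply: (lincomb4 (C / 2) (- B) ((B ^+ 2 + 1) / (2 * C)) (- (w / 2 + (2 * C)^-1)) h1 h2 h3 ABC).
by field.
Qed.

(** This is why the bounds of W are reciprocal: (A + C + C |k|) / 2 and (A + C - C |k|) / 2 have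
    product 1. *)
Lemma k_norm : C ^+ 2 * (k1 ^+ 2 + k2 ^+ 2) = (A + C) ^+ 2 - 4.
Proof.
have C0 : C != 0 by rewrite gt_eqF.
have -> : A = (1 + B * B) / C by apply: (lincomb1 C^-1 ABC); field.
by rewrite /k1 /k2; field.
Qed.
End ConstantStructure.

(** * Logarithm of a zero-free pair *)

Section Logarithm.
Variable R : realType.
Local Notation E := 'rV[R]_2.
Variables s t : E -> R.
Hypotheses (ss : smooth s) (st : smooth t).
Let n := s * s + t * t.
Hypothesis n_neq0 : forall x, n x != 0.
Let V := finv n.

Let sn : smooth n. Proof. by rewrite /n. Qed.
Let sV : smooth V. Proof. exact: smooth_finv. Qed.
Let Vn : V * n = 1.
Proof. by apply/funext => x; rewrite fctE /V finvE mulVf. Qed.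
Let pn i : pd i n = s * pd i s + s * pd i s + (t * pd i t + t * pd i t).
Proof. by rewrite /n pdD ?pdM. Qed.
Let pV i : pd i V = - (V * V * pd i n).
Proof. by rewrite /V pd_finv. Qed.

(** Real and imaginary part of d(s + i t) / (s + i t) are closed forms on the plane, hence exact. *)
Lemma log_exists : exists la th : E -> R, [/\ smooth la, smooth th,
  forall i, pd i la = (s * pd i s + t * pd i t) * V &
  forall i, pd i th = (s * pd i t - t * pd i s) * V].
Proof.
have sl i : smooth ((s * pd i s + t * pd i t) * V) by apply: smoothM => //; exact: sV.
have sth i : smooth ((s * pd i t - t * pd i s) * V) by apply: smoothM => //; exact: sV.
have [la [sla la0 la1]] : exists P : E -> R, [/\ smooth P,
    pd 0 P = (s * pd 0 s + t * pd 0 t) * V & pd 1 P = (s * pd 1 s + t * pd 1 t) * V].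
  apply: poincare => //; rewrite !pdM//; try exact: sV.
  by rewrite !pV !pn !pdD// !pdM// (pdC 1 0 ss) (pdC 1 0 st); ring.
have [th [sh th0 th1]] : exists P : E -> R, [/\ smooth P,
    pd 0 P = (s * pd 0 t - t * pd 0 s) * V & pd 1 P = (s * pd 1 t - t * pd 1 s) * V].
  apply: poincare => //; rewrite !pdM//; try exact: sV.
  rewrite !pV !pn !pdB// !pdM// (pdC 1 0 ss) (pdC 1 0 st).
  apply: (lincomb1 (- (V * ((pd 1 s * pd 0 t - pd 0 s * pd 1 t)
    + (pd 1 s * pd 0 t - pd 0 s * pd 1 t)))) Vn).
  by rewrite /n; ring.
by exists la, th; split=> // i; have [->|->] := ord2P i.
Qed.

Lemma hol_log (a b c la th : E -> R) :
  a * c - b * b = 1 -> hol a b c s t -> smooth la -> smooth th ->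
  (forall i, pd i la = (s * pd i s + t * pd i t) * V) ->
  (forall i, pd i th = (s * pd i t - t * pd i s) * V) ->
  hol a b c la th.
Proof.
move=> det1 h sla sth Hla Hth; have [_ _ r0 r1] := hol_rot det1 h.
have [_ _ t0 t1] := h; move: r0 r1; rewrite !pdN// => r0 r1.
split=> //; rewrite !Hla !Hth.
  by apply: (lincomb2 (s * V) (t * V) t0 r0); ring.
by apply: (lincomb2 (s * V) (t * V) t1 r1); ring.
Qed.

(* Twice the argument of s + i t differs from 2 th by a constant. *)
Lemma arg_log (th : E -> R) : smooth th ->
  (forall i, pd i th = (s * pd i t - t * pd i s) * V) ->
  exists G H : R, G ^+ 2 + H ^+ 2 = 1 /\ forall x,
    (s x ^+ 2 - t x ^+ 2) / n x = G * cos (2 * th x) - H * sin (2 * th x) /\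
    2 * s x * t x / n x = H * cos (2 * th x) + G * sin (2 * th x).
Proof.
move=> sth Hth; pose th2 := th + th.
have sth2 : smooth th2 by rewrite /th2.
pose co := cos \o th2; pose si := sin \o th2.
have sco : smooth co by exact: smooth_cos.
have ssi : smooth si by exact: smooth_sin.
have pth2 i : pd i th2 = (s * pd i t - t * pd i s) * V + (s * pd i t - t * pd i s) * V.
  by rewrite pdD// Hth.
have pco i : pd i co = - si * pd i th2 by exact: pd_cos.
have psi i : pd i si = co * pd i th2 by exact: pd_sin.
pose u1 := s * s - t * t; pose u2 := s * t + s * t.
have su1 : smooth u1 by rewrite /u1.
have su2 : smooth u2 by rewrite /u2.
have pu1 i : pd i u1 = s * pd i s + s * pd i s - (t * pd i t + t * pd i t).
  by rewrite pdB// !pdM//.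
have pu2 i : pd i u2 = s * pd i t + t * pd i s + (s * pd i t + t * pd i s).
  by rewrite pdD// !pdM//.
have [u1E u2E] : u1 = s * s - t * t /\ u2 = s * t + s * t by [].
have cs1 x : co x * co x + si x * si x = 1 by rewrite -!expr2 cos2Dsin2.
have coE x : co x = cos (2 * th x) by rewrite /co /th2 /= fctE mulr_natl mulr2n.
have siE x : si x = sin (2 * th x) by rewrite /si /th2 /= fctE mulr_natl mulr2n.
have sV' := sV; have Vn' := Vn; have pV' := pV; have pn' := pn.
have nE : n = s * s + t * t by [].
have nV x : (n x)^-1 = V x by [].
clearbody co si u1 u2 th2 V n.
(* G + i H is (s + i t)^2 / |s + i t|^2 times e^(-2 i th), whose derivatives vanish. *)
pose G := (u1 * co + u2 * si) * V; pose H := (u2 * co - u1 * si) * V.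
have sG : smooth G by rewrite /G.
have sH : smooth H by rewrite /H.
have pG i : pd i G = 0.
  rewrite /G pdM// pdD// !pdM// pV' pn' pu1 pu2 pco psi pth2.
  apply: (lincomb1 (- (V * (pd i u1 * co + pd i u2 * si))) Vn').
  by rewrite pu1 pu2 u1E u2E nE; ring.
have pH i : pd i H = 0.
  rewrite /H pdM// pdB// !pdM// pV' pn' pu1 pu2 pco psi pth2.
  apply: (lincomb1 (- (V * (pd i u2 * co - pd i u1 * si))) Vn').
  by rewrite pu1 pu2 u1E u2E nE; ring.
have Vx x : V x * (s x * s x + t x * t x) = 1.
  by have := congr1 (@^~ x) Vn'; rewrite nE.
have cG := const_of_pd0 sG (fun i x => congr1 (@^~ x) (pG i)).
have cH := const_of_pd0 sH (fun i x => congr1 (@^~ x) (pH i)).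
have GE x : G x = ((s x * s x - t x * t x) * co x + (s x * t x + s x * t x) * si x) * V x.
  by rewrite /G u1E u2E.
have HE x : H x = ((s x * t x + s x * t x) * co x - (s x * s x - t x * t x) * si x) * V x.
  by rewrite /H u1E u2E.
exists (G 0), (H 0); split.
  rewrite GE HE; have h1 := cs1 0; have h2 := Vx 0.
  move: h1 h2; move: (s 0) (t 0) (co 0) (si 0) (V 0) => s' t' co' si' V' h1 h2.
  apply: (lincomb2 (V' ^+ 2 * (s' * s' + t' * t') ^+ 2) (V' * (s' * s' + t' * t') + 1) h1 h2).
  by ring.
move=> x; rewrite (cG 0 x) (cH 0 x) GE HE nV -coE -siE; have h1 := cs1 x.
by split; [apply: (lincomb1 (- (s x ^+ 2 - t x ^+ 2) * V x) h1)|
  apply: (lincomb1 (- 2 * s x * t x * V x) h1)]; ring.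
Qed.
End Logarithm.

(** * Classification *)

Section Classification.
Variable R : realType.
Local Notation E := 'rV[R]_2.

Lemma affine_mapI (V W : normedModType R) (F l : V -> W) b :
  linear l -> (forall x, F x = l x + b) -> affine_map F.
Proof.
move=> lin HF; pose lM := GRing.isLinear.Build _ _ _ _ l lin.
pose L : {linear V -> W} := HB.pack l lM.
by exists L, b.
Qed.

Lemma affine_expansion (F : E -> R) : smooth F ->
  (forall i x, pd i F x = pd i F 0) ->
  forall x, F x = F 0 + (x 0 0 * pd 0 F 0 + x 0 1 * pd 1 F 0).
Proof.
move=> sF pF x; have [t _] := MVT_line 0 (fun y => is_derive_pd y x sF).
by rewrite add0r !fctE !pF => <-; rewrite addrC subrK.
Qed.

Lemma infinite_set_nat (T : Type) (A : set T) (f : nat -> T) :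
  injective f -> (forall n, A (f n)) -> infinite_set A.
Proof.
move=> fI fA finA; apply: infinite_nat.
have : finite_set (f @^-1` A) by apply: finite_preimage => // x y _ _; exact: fI.
by apply: sub_finite_set => n _; exact: fA.
Qed.

Variable f : E -> E.
Hypothesis sf : smooth f.
Local Notation p := (nullp f).
Local Notation m := (nullm f).

Lemma null_decomp x : f x = (p x / 2) *: (delta_mx 0 0 + delta_mx 0 1)
  + (m x / 2) *: (delta_mx 0 0 - delta_mx 0 1).
Proof.
apply/rowP => j; rewrite !mxE /nullp /nullm.
by have [->|->] := ord2P j; rewrite /=; field.
Qed.

Lemma affine_of_null : (forall i x, pd i p x = pd i p 0) ->
  (forall i x, pd i m x = pd i m 0) -> affine_map f.
Proof.
move=> pp pm.
have sp := smooth_nullp sf; have sm := smooth_nullm sf.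
pose y0 : E := delta_mx 0 0 + delta_mx 0 1; pose y1 : E := delta_mx 0 0 - delta_mx 0 1.
pose l (x : E) : E := ((x 0 0 * pd 0 p 0 + x 0 1 * pd 1 p 0) / 2) *: y0
  + ((x 0 0 * pd 0 m 0 + x 0 1 * pd 1 m 0) / 2) *: y1.
apply: (@affine_mapI _ _ f l (f 0)) => [k u v|x].
  by apply/rowP => j; rewrite /l !mxE; ring.
rewrite (null_decomp x) (null_decomp 0) (affine_expansion sp pp) (affine_expansion sm pm) /l -/y0 -/y1.
by clearbody y0 y1; apply/rowP => j; rewrite !mxE; field.
Qed.

Lemma lightlike_case (h : E -> R) (s : bool) (y1 : E) :
  let y0 := delta_mx 0 0 + (-1) ^+ s *: delta_mx 0 1 : E in
  smooth h -> pd 0 (pd 0 h) + pd 1 (pd 1 h) = 0 ->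
  (forall x, f x = h x *: y0 + y1) -> (forall x, Wfun f x = 1) ->
  case_affine f 1 \/ case_lightlike f.
Proof.
move=> y0 sh lh fE W1; have [ah|nah] := pselect (affine_map h).
  left; split=> //; have [L [b hE]] := ah.
  apply: (@affine_mapI _ _ f (fun x => L x *: y0) (b *: y0 + y1)) => [k u v|x].
    by rewrite linearP scalerDl scalerA.
  by rewrite fE hE scalerDl addrA.
right; split=> //; exists h, y0, y1; split=> //.
- split; first exact: sh.
  by move=> x; rewrite sum_ord2 -!pdE; exact: (congr1 (@^~ x) lh).
- apply/eqP => /matrixP/(_ 0 0); rewrite !mxE/= mulr0 addr0 => /eqP.
  by rewrite oner_eq0.
- by rewrite /lightlike mink2 !mxE/= !mulr1 !mulr0 addr0 add0r mulr1 -expr2 sqrr_sign subrr.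
Qed.
End Classification.

(** * The trichotomy for a constant structure *)

Section ConstantClassification.
Variables (R : realType) (A B C : R) (f : 'rV[R]_2 -> 'rV[R]_2).
Local Notation E := 'rV[R]_2.
Hypothesis sf : smooth f.
Local Notation p := (nullp f).
Local Notation m := (nullm f).
Local Notation W := (Wfun f).
Local Notation a := (cst A : E -> R).
Local Notation b := (cst B : E -> R).
Local Notation c := (cst C : E -> R).
Hypothesis cs : conformal_structure p m W a b c.

Let C_gt0 : 0 < C. Proof. exact: cs_c_gt0 cs 0. Qed.
Let ABC : A * C - B * B = 1. Proof. exact: (congr1 (@^~ 0) (cs_det cs)). Qed.
Let sp : smooth p := cs_smooth_p cs.
Let sm : smooth m := cs_smooth_m cs.
Let k1 : R := (1 - B ^+ 2) / C ^+ 2 - 1.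
Let k2 : R := - 2 * B / C ^+ 2.
Let hp : hol a b c (dre B C p) (dim C p) := hol_d C_gt0 ABC sp (cs_lap_p cs).
Let hm : hol a b c (dre B C m) (dim C m) := hol_d C_gt0 ABC sm (cs_lap_m cs).
Let A_gt0 : 0 < A.
Proof. exact: (a_gt0 (cs_det cs) (cs_c_gt0 cs) 0). Qed.

(** Here alpha beta = 0. If alpha is nonzero at some point, it is nonzero nearby, so beta vanishes
    on an open set and by unique continuation everywhere. *)
Lemma degenerate_null : k1 = 0 -> k2 = 0 ->
  (forall x, dre B C p x = 0 /\ dim C p x = 0) \/
  (forall x, dre B C m x = 0 /\ dim C m x = 0).
Proof.
move=> k10 k20.
have [?|/existsNP[x0 nx0]] := pselect (forall x, dre B C p x = 0 /\ dim C p x = 0).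
  by left.
right; apply: (hol_unique (cs_smooth_a cs) (cs_smooth_b cs) (cs_smooth_c cs)
   (cs_det cs) (cs_closed_ab cs) (cs_closed_bc cs) (cs_c_gt0 cs) (x0 := x0) hm).
pose N := dre B C p * dre B C p + dim C p * dim C p.
have sN : smooth N.
  by have [? ? _ _] := hp; rewrite /N.
have NE y : N y = dre B C p y ^+ 2 + dim C p y ^+ 2 by rewrite /N !fctE !expr2.
have N0 : 0 < N x0.
  rewrite lt_neqAle NE addr_ge0 ?sqr_ge0// andbT eq_sym; apply/eqP => /eqP.
  by rewrite paddr_eq0 ?sqr_ge0// !sqrf_eq0 => /andP[/eqP h1 /eqP h2]; apply: nx0.
near=> y.
have Ny : N y != 0.
  by rewrite gt_eqF//; near: y; apply: (cvgr_gt (N x0)) => //; exact: smooth_continuous.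
have h1 := dd_re C_gt0 ABC cs y; have h2 := dd_im C_gt0 cs y.
rewrite -/k1 k10 in h1; rewrite -/k2 k20 in h2.
rewrite NE in Ny.
split; apply: (mulfI Ny); rewrite mulr0.
  by apply: (lincomb2 (dre B C p y) (dim C p y) h1 h2); ring.
by apply: (lincomb2 (- dim C p y) (dre B C p y) h1 h2); ring.
Unshelve. all: by end_near. Qed.

Lemma degenerate_classify : k1 = 0 -> k2 = 0 -> case_affine f 1 \/ case_lightlike f.
Proof.
move=> k10 k20.
(* k = 0 forces A + C = 2, and with A C - B^2 = 1 the structure is Euclidean: harmonicity becomes
   the ordinary one. *)
have kn := k_norm C_gt0 ABC; rewrite -/k1 -/k2 k10 k20 in kn.
have T2 : A + C = 2.
  have : (A + C) ^+ 2 = 2 ^+ 2 by apply: (lincomb1 (-1) kn); ring.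
  by move/eqP; rewrite eqf_sqr => /orP[/eqP//|/eqP h]; have := C_gt0; have := A_gt0; lra.
have B0 : B = 0.
  have := sqr_ge0 (A - C); have := sqr_ge0 B => h1 h2.
  apply/eqP; rewrite -sqrf_eq0; apply/eqP; apply/le_anti; rewrite h1 andbT.
  have := ABC; have := congr1 (fun z => z * z) T2; nra.
have AC : A * C = 1 by have := ABC; rewrite B0 mulr0 subr0.
have A1 : A = 1.
  have CE : C = 2 - A by lra.
  have : (A - 1) ^+ 2 = 0 by move: AC; rewrite CE => h; apply: (lincomb1 (-1) h); ring.
  by move/eqP; rewrite sqrf_eq0 subr_eq0 => /eqP.
have C1 : C = 1 by lra.
have hl F : lap a b c F = 0 -> smooth F -> pd 0 (pd 0 (cst 2^-1 * F)) + pd 1 (pd 1 (cst 2^-1 * F)) = 0.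
  move=> L sF; rewrite !pd_cstM//; apply/funext => x.
  have : _ = (0 : R) := congr1 (@^~ x) L; rewrite /lap B0 A1 C1 !fctE => h.
  by rewrite -[RHS]/(0 : R); apply: (lincomb1 2^-1 h); ring.
have W1 x : (dre B C p x = 0 /\ dim C p x = 0) \/ (dre B C m x = 0 /\ dim C m x = 0) -> W x = 1.
  move=> h; rewrite (W_dd C_gt0 ABC cs x) T2.
  by case: h => -[-> ->]; field.
have [d0|d0] := degenerate_null k10 k20.
- have pc := const_of_d0 C_gt0 sp d0.
  apply: (@lightlike_case _ _ (cst 2^-1 * m) true ((p 0 / 2) *: (delta_mx 0 0 + delta_mx 0 1))).
  + by [].
  + exact: hl (cs_lap_m cs) sm.
  + move=> x; rewrite (null_decomp f x) (pc x 0) addrC; congr (_ *: _ + _).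
      by rewrite fctE mulrC.
    by rewrite expr1 scaleN1r.
  + by move=> x; apply: W1; left.
- have pc := const_of_d0 C_gt0 sm d0.
  apply: (@lightlike_case _ _ (cst 2^-1 * p) false ((m 0 / 2) *: (delta_mx 0 0 - delta_mx 0 1))).
  + by [].
  + exact: hl (cs_lap_p cs) sp.
  + move=> x; rewrite (null_decomp f x) (pc x 0); congr (_ *: _ + _).
      by rewrite fctE mulrC.
    by rewrite expr0 scale1r.
  + by move=> x; apply: W1; right.
Qed.

Let s := dre B C p.
Let t := dim C p.
Let n := s * s + t * t.

(** beta = k conj(alpha) / |alpha|^2 is constant along with alpha. *)
Lemma constant_derivatives : (forall x y, s x = s y) -> (forall x y, t x = t y) ->
  (forall x, n x != 0) ->
  affine_map f /\ forall x, W x = W 0.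
Proof.
move=> cs' ct n0.
have nE y : n y = s y ^+ 2 + t y ^+ 2 by rewrite /n !fctE !expr2.
have mre x : dre B C m x = (k1 * s x + k2 * t x) / n x.
  have h1 := dd_re C_gt0 ABC cs x; have h2 := dd_im C_gt0 cs x.
  rewrite -/k1 -/k2 -/s -/t in h1 h2; apply: (mulfI (n0 x)).
  rewrite mulrC [RHS]mulrC divfK// nE.
  by apply: (lincomb2 (s x) (t x) h1 h2); ring.
have mim x : dim C m x = (k2 * s x - k1 * t x) / n x.
  have h1 := dd_re C_gt0 ABC cs x; have h2 := dd_im C_gt0 cs x.
  rewrite -/k1 -/k2 -/s -/t in h1 h2; apply: (mulfI (n0 x)).
  rewrite mulrC [RHS]mulrC divfK// nE.
  by apply: (lincomb2 (- t x) (s x) h1 h2); ring.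
have nc x y : n x = n y by rewrite !nE (cs' x y) (ct x y).
have mrc x y : dre B C m x = dre B C m y by rewrite !mre (nc x y) (cs' x y) (ct x y).
have mic x y : dim C m x = dim C m y by rewrite !mim (nc x y) (cs' x y) (ct x y).
split.
  apply: affine_of_null => // i x; have [->|->] := ord2P i;
    rewrite ?(pd0_dre B C_gt0 _ x) ?(pd0_dre B C_gt0 _ 0) ?(pd1_dim C_gt0 _ x) ?(pd1_dim C_gt0 _ 0);
    rewrite ?(mrc x 0) ?(mic x 0) -?/s -?/t ?(cs' x 0) ?(ct x 0)//.
by move=> x; rewrite !(W_dd C_gt0 ABC cs) (mrc x 0) (mic x 0) -/s -/t (cs' x 0) (ct x 0).
Qed.
Lemma IVT_plane (F : E -> R) x y v : continuous F -> F y < v < F x ->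
  exists z, F z = v.
Proof.
move=> cF /andP[vy vx].
have cl : continuous (fun u : R => F (y + u *: (x - y))).
  move=> u; apply: (@continuous_comp _ _ _ (fun u : R => y + u *: (x - y)) F); last exact: cF.
  apply: (@continuousD _ _ _ (cst y) (fun u : R => u *: (x - y))); first exact: cst_continuous.
  by apply: continuousZr_tmp; exact: cvg_id.
have [||u _ Hu] := @IVT R (fun u : R => F (y + u *: (x - y))) 0 1 v ler01.
- exact: continuous_subspaceT.
- rewrite scale0r addr0 scale1r addrC subrK ge_min le_max (ltW vx) (ltW vy).
  by rewrite orbT.
by exists (y + u *: (x - y)).
Qed.

Lemma nondegenerate_classify : k1 ^+ 2 + k2 ^+ 2 != 0 ->
  (exists r, 0 < r /\ case_affine f r) \/ exists r, 1 < r /\ case_oscillating f r.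
Proof.
move=> k0.
have nE y : n y = s y ^+ 2 + t y ^+ 2 by rewrite /n !fctE !expr2.
have W0 x : 0 < W x by exact: cs_W_gt0 cs x.
have [ss st _ _] := hp; rewrite -/s -/t in ss st.
have re x := dd_re C_gt0 ABC cs x; have im x := dd_im C_gt0 cs x.
have n0 x : n x != 0.
  apply: contraNneq k0 => nx; rewrite /k1 /k2 -(re x) -(im x).
  have : (s x == 0) && (t x == 0).
    by have := nx; rewrite nE => /eqP; rewrite paddr_eq0 ?sqr_ge0// !sqrf_eq0.
  by rewrite /s /t => /andP[/eqP -> /eqP ->]; apply/eqP; ring.
have [la [th [sla sth Hla Hth]]] := log_exists ss st n0.
have hl : hol a b c la th := hol_log ss (cs_det cs) hp sla sth Hla Hth.
have fixed : (forall i x, pd i la x = 0) -> (forall i x, pd i th x = 0) ->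
    exists r, 0 < r /\ case_affine f r.
  move=> l0 t0.
  have st0 i x : s x * pd i s x + t x * pd i t x = 0 /\ s x * pd i t x - t x * pd i s x = 0.
    have h1 := l0 i x; have h2 := t0 i x; rewrite Hla fctE in h1; rewrite Hth fctE in h2.
    have Vn0 : finv (s * s + t * t) x != 0 by rewrite finvE invr_eq0 n0.
    by split; apply: (mulIf Vn0); rewrite mul0r ?h1 ?h2.
  have s0 i x : pd i s x = 0.
    have [h1 h2] := st0 i x; apply: (mulfI (n0 x)); rewrite mulr0 nE.
    by apply: (lincomb2 (s x) (- t x) h1 h2); ring.
  have tt0 i x : pd i t x = 0.
    have [h1 h2] := st0 i x; apply: (mulfI (n0 x)); rewrite mulr0 nE.
    by apply: (lincomb2 (t x) (s x) h1 h2); ring.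
  have [aff Wc] := constant_derivatives (const_of_pd0 ss s0) (const_of_pd0 st tt0) n0.
  by exists (W 0).
have const F : smooth F -> (forall x y, F x = F y) -> forall i x, pd i F x = 0.
  move=> sF Fc i x; have -> : F = cst (F 0) by apply/funext => y; exact: Fc.
  by rewrite pd_cst.
have bounded s' t' M : hol a b c s' t' -> (forall x, s' x <= M) ->
    (forall x y, s' x = s' y) /\ (forall x y, t' x = t' y).
  move=> h bd; split=> x y;
    by have [] := hol_bounded_above (cs_smooth_a cs) (cs_smooth_b cs) (cs_smooth_c cs)
     (cs_det cs) (cs_closed_ab cs) (cs_closed_bc cs) (cs_c_gt0 cs) h bd x y.
(* -i log alpha has real part th, so an upper bound on th already makes the logarithm constant. *)
have hr := hol_rot (cs_det cs) hl.
have [[M bdM]|nbdM] := pselect (exists M, forall x, th x <= M).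
  left; have [thc lac] := bounded _ _ _ hr bdM.
  apply: fixed; apply: const => // x y.
  by have := lac x y; rewrite !fctE => /oppr_inj.
(* Two more rotations give i log alpha, with real part -th, for the case where th is bounded
   below. *)
have hr3 := hol_rot (cs_det cs) (hol_rot (cs_det cs) hr).
have [[M bdM]|nbdM'] := pselect (exists M, forall x, (- th) x <= M).
  left; have [thc lac] := bounded _ _ _ hr3 bdM.
  apply: fixed; apply: const => // x y.
    by have := lac x y; rewrite !fctE !opprK.
  by have := thc x y; rewrite !fctE => /oppr_inj.
right.
have th_onto v : exists x, th x = v.
  have [x vx] : exists x, v < th x.
    apply: contrapT => h; apply: nbdM; exists v => x; rewrite leNgt; apply/negP => vx.
    by apply: h; exists x.
  have [y vy] : exists x, th x < v.
    apply: contrapT => h; apply: nbdM'; exists (- v) => y; rewrite fctE lerN2 leNgt; apply/negP => vy.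
    by apply: h; exists y.
  by apply: (@IVT_plane th x y) => //; [exact: smooth_continuous|rewrite vx vy].
have [G [H [GH argE]]] := arg_log ss st n0 sth Hth.
(* alpha conj(beta) = conj(k) alpha^2 / |alpha|^2, and alpha^2 / |alpha|^2 = (G + i H) e^(2 i th); P
   and -Q are the real and imaginary parts of conj(k) (G + i H). *)
pose P := k1 * G + k2 * H; pose Q := k2 * G - k1 * H.
have PQ : P ^+ 2 + Q ^+ 2 = k1 ^+ 2 + k2 ^+ 2.
  by apply: (lincomb1 (k1 ^+ 2 + k2 ^+ 2) GH); rewrite /P /Q; ring.
have WE x : W x = (A + C) / 2 + C / 2 * (P * cos (2 * th x) + Q * sin (2 * th x)).
  rewrite (W_dd C_gt0 ABC cs x); congr (_ + _ * _).
  have [h1 h2] := argE x; have h3 := re x; have h4 := im x.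
  rewrite -/k1 -/s -/t in h3; rewrite -/k2 -/s -/t in h4.
  have -> : P * cos (2 * th x) + Q * sin (2 * th x) =
     k1 * ((s x ^+ 2 - t x ^+ 2) / n x) + k2 * (2 * s x * t x / n x).
    by rewrite h1 h2 /P /Q; ring.
  apply: (mulfI (n0 x)).
  have -> : n x * (k1 * ((s x ^+ 2 - t x ^+ 2) / n x) + k2 * (2 * s x * t x / n x))
     = k1 * (s x ^+ 2 - t x ^+ 2) + k2 * (2 * s x * t x) by field; exact: n0.
  by rewrite nE -/s -/t; apply: (lincomb2 (s x ^+ 2 - t x ^+ 2) (2 * s x * t x) h3 h4); ring.
have kn := k_norm C_gt0 ABC; rewrite -/k1 -/k2 in kn.
have T0 : 0 < A + C by rewrite addr_gt0.
have kpos : 0 < k1 ^+ 2 + k2 ^+ 2 by rewrite lt_neqAle eq_sym k0 addr_ge0 ?sqr_ge0.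
have D2 : 0 < (A + C) ^+ 2 - 4 by rewrite -kn mulr_gt0// exprn_gt0.
pose D := Num.sqrt ((A + C) ^+ 2 - 4).
have D0 : 0 < D by rewrite sqrtr_gt0.
have DD : D ^+ 2 = (A + C) ^+ 2 - 4 by rewrite sqr_sqrtr// ltW.
clearbody D.
pose r := (A + C + D) / 2.
have T2 : 2 < A + C by move: D2 T0; nra.
have r1 : 1 < r by rewrite /r; lra.
have rV : r^-1 = (A + C - D) / 2.
  apply: (mulfI (lt0r_neq0 (lt_trans ltr01 r1))); rewrite mulfV ?gt_eqF ?(lt_trans ltr01)//.
  by rewrite /r; apply: (lincomb1 (1 / 4) DD); field.
exists r; split=> // w /andP[w0 w1]; rewrite rV in w0; rewrite /r in w1.
have DC0 : 0 < D / C by rewrite divr_gt0.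
have PQD : P ^+ 2 + Q ^+ 2 = (D / C) ^+ 2.
  rewrite PQ; move: (k1 ^+ 2 + k2 ^+ 2) kn => K kn.
  by apply: (lincomb2 (C ^- 2) (- C ^- 2) kn DD); field; rewrite gt_eqF.
have [|tau Htau] := @cos_sin_attains R P Q (D / C) ((w - (A + C) / 2) * 2 / C) DC0 PQD.
  rewrite -mulNr !ler_pM2r ?invr_gt0//; apply/andP; split; lra.
(* Shifting th by pi shifts 2 th by a full period: W is unchanged, while the points differ because
   their th-values do. *)
have [x Hx] := choice (fun k : nat => th_onto (tau / 2 + pi *+ k)).
apply: (@infinite_set_nat _ _ x) => [k l kl|k] /=.
  have := Hx k; rewrite kl Hx => /addrI.
  rewrite -![pi *+ _]mulr_natr => /(mulfI (lt0r_neq0 (@pi_gt0 R))) /eqP.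
  by rewrite eqr_nat => /eqP.
have e2 : 2 * th (x k) = tau + (pi *+ 2) *+ k.
  rewrite Hx mulrDr; congr (_ + _); first by field.
  by rewrite mulr_natl mulrnAC.
rewrite WE e2 (periodicn (@cosD2pi R)) (periodicn (@sinD2pi R)) Htau.
by field; rewrite gt_eqF.
Qed.
End ConstantClassification.

(** * Examples *)

Section Examples.
Variable R : realType.
Local Notation E := 'rV[R]_2.

Lemma class_C_exp k (F : E -> R) : class_C k F -> class_C k (expR \o F).
Proof.
have dexp (z : R) : is_derive z 1 expR (expR z) := is_derive_expR z.
elim: k F => [|k IH] F.
  move=> cF x; apply: continuous_comp; first exact: cF.
  exact: continuous_expR.
move=> cF; have [dF pF] := cF; split=> [x|i].
  exact: (partial_comp1 0 dexp dF).1.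
rewrite (partial_comp1 i dexp dF).2; apply: class_CM; last exact: pF.
by apply: IH; exact: class_C_S.
Qed.

Lemma smooth_exp (F : E -> R) : smooth F -> smooth (expR \o F).
Proof. by move=> sF k; exact: class_C_exp. Qed.

Lemma pd_exp i (F : E -> R) : smooth F -> pd i (expR \o F) = (expR \o F) * pd i F.
Proof.
move=> sF; rewrite !pdE; have dF x := smooth_differentiable x sF.
have dexp (z : R) : is_derive z 1 expR (expR z) := is_derive_expR z.
by rewrite (partial_comp1 i dexp dF).2.
Qed.

Definition of_null (p m : E -> R) (x : E) : E :=
  (p x / 2) *: (delta_mx 0 0 + delta_mx 0 1) + (m x / 2) *: (delta_mx 0 0 - delta_mx 0 1).

Lemma of_nullE p m x : of_null p m x 0 0 = (p x + m x) / 2 /\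
  of_null p m x 0 1 = (p x - m x) / 2.
Proof. by rewrite !mxE /=; split; field. Qed.

Lemma nullp_of_null p m : nullp (of_null p m) = p.
Proof.
by apply/funext => x; rewrite /nullp; have [-> ->] := of_nullE p m x; field.
Qed.

Lemma nullm_of_null p m : nullm (of_null p m) = m.
Proof.
by apply/funext => x; rewrite /nullm; have [-> ->] := of_nullE p m x; field.
Qed.

Lemma smooth_of_null p m : smooth p -> smooth m -> smooth (of_null p m).
Proof.
move=> sp sm k; apply: (@class_CD _ _ k (fun x => (p x / 2) *: _) (fun x => (m x / 2) *: _)).
  by apply: (@class_CZl _ _ k (p * cst 2^-1)); apply: class_CM; [exact: sp|exact: class_C_cst].
by apply: (@class_CZl _ _ k (m * cst 2^-1)); apply: class_CM; [exact: sm|exact: class_C_cst].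
Qed.

Lemma diagonal_stationary (p m g0 g1 : E -> R) : smooth p -> smooth m ->
  (forall x, pd 0 p x * pd 1 m x + pd 0 m x * pd 1 p x = 0) ->
  (forall x, g0 x = 1 + pd 0 p x * pd 0 m x) -> (forall x, 0 < g0 x) ->
  (forall x, g1 x = 1 + pd 1 p x * pd 1 m x) -> (forall x, 0 < g1 x) ->
  (forall F, F = p \/ F = m -> forall x,
     g1 x * pd 0 (pd 0 F) x + g0 x * pd 1 (pd 1 F) x = 0) ->
  spacelike_stationary (of_null p m) /\
  forall x, Wfun (of_null p m) x = Num.sqrt (g0 x * g1 x).
Proof.
move=> sp sm h01 g0E g0_gt0 g1E g1_gt0 L.
have sf := smooth_of_null sp sm.
have e00 x : graph_metric (of_null p m) x 0 0 = g0 x.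
  by rewrite graph_metric_null// nullp_of_null nullm_of_null g0E /=; field.
have e11 x : graph_metric (of_null p m) x 1 1 = g1 x.
  by rewrite graph_metric_null// nullp_of_null nullm_of_null g1E /=; field.
have e01 x : graph_metric (of_null p m) x 0 1 = 0.
  by rewrite graph_metric_null// nullp_of_null nullm_of_null h01 /= mul0r addr0.
have e10 x : graph_metric (of_null p m) x 1 0 = 0 by rewrite graph_metric_sym// e01.
split; last by move=> x; rewrite /Wfun det2 e00 e11 e01 e10 mul0r subr0.
split=> [x v v0|x].
  rewrite quadE e00 e11 e01 e10 addr0 mulr0 addr0.
  have : (v 0 0 != 0) || (v 0 1 != 0).
    rewrite -negb_and; apply: contra v0 => /andP[/eqP h0 /eqP h1].
    by apply/eqP/rowP => j; rewrite mxE; have [->|->] := ord2P j.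
  move=> /orP[h|h].
    apply: ltr_pwDl; first by rewrite mulr_gt0// exprn_even_gt0.
    by rewrite mulr_ge0 ?sqr_ge0// ltW.
  apply: ltr_wpDl; first by rewrite mulr_ge0 ?sqr_ge0// ltW.
  by rewrite mulr_gt0// exprn_even_gt0.
have d0 : 0 < graph_metric (of_null p m) x 0 0 * graph_metric (of_null p m) x 1 1
    - graph_metric (of_null p m) x 0 1 ^+ 2.
  by rewrite e00 e11 e01 expr0n/= subr0 mulr_gt0.
apply: (mean_curvature_null sf d0).2 => F; rewrite nullp_of_null nullm_of_null e00 e11 e01.
by move=> /L /(_ x) h; apply: (lincomb1 1 h); ring.
Qed.

(** Null coordinates p = (r^2 - 1) x_0 and m = x_0 give the diagonal metric (r^2, 1), uniformly for
    r below, equal to or above 1. *)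
Lemma affine_example (r : R) : 0 < r ->
  exists f : E -> E, [/\ smooth f, spacelike_stationary f & case_affine f r].
Proof.
move=> r0; pose X (x : E) := x 0 0.
have sX : smooth X by exact: smooth_coord.
have pX0 : pd 0 X = cst 1 by exact: pd_coord.
have pX1 : pd 1 X = cst 0 by exact: pd_coord.
clearbody X; pose p := cst (r ^+ 2 - 1) * X.
have sp : smooth p by rewrite /p.
have pp0 : pd 0 p = cst (r ^+ 2 - 1).
  by rewrite /p pd_cstM// pX0; apply/funext => x; rewrite !fctE mulr1.
have pp1 : pd 1 p = cst 0.
  by rewrite /p pd_cstM// pX1; apply/funext => x; rewrite !fctE mulr0.
clearbody p.
have [||||||st WE] := @diagonal_stationary p X (cst (r ^+ 2)) (cst 1) sp sX.
- by move=> x; rewrite pp0 pp1 pX0 pX1 !fctE; ring.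
- by move=> x; rewrite pp0 pX0 !fctE; ring.
- by move=> x; rewrite exprn_gt0.
- by move=> x; rewrite pp1 pX1 !fctE; ring.
- by move=> x; exact: ltr01.
- by move=> F [->|->] x; rewrite ?pp0 ?pp1 ?pX0 ?pX1 !pd_cst !fctE; ring.
exists (of_null p X); split=> //; first exact: smooth_of_null.
split; last by move=> x; rewrite WE fctE mulr1 sqrtr_sqr gtr0_norm.
apply: affine_of_null; first exact: smooth_of_null.
  by rewrite nullp_of_null => i x; have [->|->] := ord2P i; rewrite ?pp0 ?pp1.
by rewrite nullm_of_null => i x; have [->|->] := ord2P i; rewrite ?pX0 ?pX1.
Qed.

(* p = e^x cos(r y) and m = - k e^(-x) cos(r y) with k = r^-2 - 1, for which
   W = cos(r y)^2 / r + r sin(r y)^2. *)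
Lemma oscillating_example (r : R) : 1 < r ->
  exists f : E -> E, [/\ smooth f, spacelike_stationary f & case_oscillating f r].
Proof.
move=> r1; have r0 : 0 < r by apply: lt_trans r1.
have rn0 : r != 0 by rewrite gt_eqF.
pose X (x : E) := x 0 0; pose Y (x : E) := x 0 1.
have sX : smooth X by exact: smooth_coord.
have sY : smooth Y by exact: smooth_coord.
have pX0 : pd 0 X = cst 1 by exact: pd_coord.
have pX1 : pd 1 X = cst 0 by exact: pd_coord.
have pY0 : pd 0 Y = cst 0 by exact: pd_coord.
have pY1 : pd 1 Y = cst 1 by exact: pd_coord.
(* The structure is A = 1 / r, B = 0, C = r, with z = x + i r y. Then p = Re e^z has alpha = e^z,
   and k is the value of alpha beta prescribed by conformality, so beta = k e^(-z). *)
pose k : R := (r ^+ 2)^-1 - 1.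
pose ex := expR \o X; pose en := expR \o (- X).
pose co := cos \o (cst r * Y); pose si := sin \o (cst r * Y).
have srY : smooth (cst r * Y) by [].
have sex : smooth ex by exact: smooth_exp.
have sen : smooth en by apply: smooth_exp.
have sco : smooth co by exact: smooth_cos.
have ssi : smooth si by exact: smooth_sin.
have pr0 : pd 0 (cst r * Y) = cst 0.
  by rewrite pd_cstM// pY0; apply/funext => x; rewrite !fctE mulr0.
have pr1 : pd 1 (cst r * Y) = cst r.
  by rewrite pd_cstM// pY1; apply/funext => x; rewrite !fctE mulr1.
have pex0 : pd 0 ex = ex.
  by rewrite pd_exp// pX0; apply/funext => x; rewrite !fctE mulr1.
have pex1 : pd 1 ex = cst 0.
  by rewrite pd_exp// pX1; apply/funext => x; rewrite !fctE mulr0.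
have pen0 : pd 0 en = - en.
  by rewrite pd_exp// pdN// pX0; apply/funext => x; rewrite !fctE mulrN1.
have pen1 : pd 1 en = cst 0.
  by rewrite pd_exp// pdN// pX1; apply/funext => x; rewrite !fctE oppr0 mulr0.
have pco0 : pd 0 co = cst 0.
  by rewrite pd_cos// pr0; apply/funext => x; rewrite !fctE mulr0.
have pco1 : pd 1 co = - (cst r * si).
  by rewrite pd_cos// pr1; apply/funext => x; rewrite !fctE mulNr mulrC.
have psi0 : pd 0 si = cst 0.
  by rewrite pd_sin// pr0; apply/funext => x; rewrite !fctE mulr0.
have psi1 : pd 1 si = cst r * co.
  by rewrite pd_sin// pr1; apply/funext => x; rewrite !fctE mulrC.
have ee x : ex x * en x = 1 by rewrite /ex /en /= expRN mulfV// gt_eqF// expR_gt0.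
have cs x : co x ^+ 2 + si x ^+ 2 = 1 by exact: cos2Dsin2.
have siE x : si x = sin (r * x 0 1) by [].
clearbody ex en co si X Y.
pose p := ex * co; pose m := cst (- k) * (en * co).
have sp : smooth p by rewrite /p.
have sm : smooth m by rewrite /m.
have pp0 : pd 0 p = ex * co.
  by rewrite /p pdM// pex0 pco0; apply/funext => x; rewrite !fctE; ring.
have pp1 : pd 1 p = cst (- r) * (ex * si).
  by rewrite /p pdM// pex1 pco1; apply/funext => x; rewrite !fctE; ring.
have pm0 : pd 0 m = cst k * (en * co).
  by rewrite /m pd_cstM// pdM// pen0 pco0; apply/funext => x; rewrite !fctE; ring.
have pm1 : pd 1 m = cst (k * r) * (en * si).
  by rewrite /m pd_cstM// pdM// pen1 pco1; apply/funext => x; rewrite !fctE; ring.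
clearbody p m.
pose g0 x := si x ^+ 2 + co x ^+ 2 / r ^+ 2.
have g0_gt0 x : 0 < g0 x.
  rewrite /g0; have -> : si x ^+ 2 = 1 - co x ^+ 2 by apply: (lincomb1 1 (cs x)); ring.
  have [c0|c0] := eqVneq (co x) 0; first by rewrite c0 expr0n/= mul0r; lra.
  have : co x ^+ 2 <= 1 by rewrite -(cs x) lerDl sqr_ge0.
  have : 0 < co x ^+ 2 / r ^+ 2 by apply: divr_gt0; [rewrite exprn_even_gt0|exact: exprn_gt0].
  by move: (co x ^+ 2) (_ / _) => u v; lra.
pose g1 x := r ^+ 2 * g0 x.
have [||||||st WE] := @diagonal_stationary p m g0 g1 sp sm.
- by move=> x; rewrite pp0 pp1 pm0 pm1 !fctE; ring.
- move=> x; rewrite pp0 pm0 !fctE /g0 /k.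
  by apply: (lincomb2 (- (r ^- 2 - 1) * co x ^+ 2) 1 (ee x) (cs x)); field.
- exact: g0_gt0.
- move=> x; rewrite pp1 pm1 !fctE /g1 /g0 /k.
  by apply: (lincomb2 ((1 - r ^+ 2) * si x ^+ 2) 1 (ee x) (cs x)); field.
- by move=> x; rewrite mulr_gt0// exprn_gt0.
- have p00 : pd 0 (pd 0 p) = ex * co.
    by rewrite pp0 pdM// pex0 pco0; apply/funext => x; rewrite !fctE; ring.
  have p11 : pd 1 (pd 1 p) = cst (- r ^+ 2) * (ex * co).
    by rewrite pp1 pd_cstM// pdM// pex1 psi1; apply/funext => x; rewrite !fctE; ring.
  have m00 : pd 0 (pd 0 m) = cst (- k) * (en * co).
    by rewrite pm0 pd_cstM// pdM// pen0 pco0; apply/funext => x; rewrite !fctE; ring.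
  have m11 : pd 1 (pd 1 m) = cst (k * r ^+ 2) * (en * co).
    by rewrite pm1 pd_cstM// pdM// pen1 psi1; apply/funext => x; rewrite !fctE; ring.
  by move=> F [->|->] x; rewrite ?p00 ?p11 ?m00 ?m11 !fctE /g1; ring.
exists (of_null p m); split=> //; first exact: smooth_of_null.
have WE' x : Wfun (of_null p m) x = co x ^+ 2 / r + r * si x ^+ 2.
  rewrite WE (_ : g0 x * g1 x = (r * g0 x) ^+ 2); last by rewrite /g1; ring.
  rewrite sqrtr_sqr gtr0_norm ?mulr_gt0//.
  by rewrite /g0; field.
move=> w /andP[w0 w1].
(* The value of sin(r y)^2 that solves W = w, as W = r^-1 + (r - r^-1) sin(r y)^2. W is independent
   of x_0, so varying x_0 gives infinitely many points. *)
pose q := (w - r^-1) / (r - r^-1).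
have rV1 : r^-1 < 1 by rewrite invf_lt1.
have rrV : 0 < r - r^-1 by lra.
have q0 : 0 <= q by rewrite divr_ge0 ?(ltW rrV)// subr_ge0.
have q1 : q <= 1 by rewrite ler_pdivrMr// mul1r lerD2r.
have sq1 : Num.sqrt q <= 1 by rewrite -sqrtr1 ler_sqrt.
have asinq : sin (asin (Num.sqrt q)) = Num.sqrt q.
  by apply: asinK; rewrite in_itv/= sq1 andbT (le_trans _ (sqrtr_ge0 _))// oppr_le0.
pose z (n : nat) : E := n%:R *: delta_mx 0 0 + (asin (Num.sqrt q) / r) *: delta_mx 0 1.
apply: (@infinite_set_nat _ _ z) => [i j /matrixP/(_ 0 0)|n] /=.
  by rewrite !mxE/= !mulr0 !addr0 !mulr1 => /eqP; rewrite eqr_nat => /eqP.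
have sz : si (z n) = Num.sqrt q.
  by rewrite siE !mxE/= mulr0 add0r mulr1 mulrC divfK.
have sz2 : si (z n) ^+ 2 = q by rewrite sz sqr_sqrtr.
have qE : q * (r - r^-1) = w - r^-1 by rewrite /q divfK// gt_eqF.
rewrite WE'; apply: (lincomb3 (r^-1) (r - r^-1) 1 (cs (z n)) sz2 qE); ring.
Qed.
End Examples.

(** * Mutual exclusion of the cases *)

Section Exclusion.
Variable R : realType.
Local Notation E := 'rV[R]_2.

Lemma affine_lightlike_factor (f : E -> E) (h : E -> R) (y0 y1 : E) :
  affine_map f -> y0 != 0 -> (forall x, f x = h x *: y0 + y1) -> affine_map h.
Proof.
move=> [L [b fE]] y00 fh.
have [j yj] : exists j, y0 0 j != 0.
  apply: contrapT => n0; move/eqP: y00; apply; apply/rowP => j; rewrite mxE.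
  by apply: contrapT => /eqP yj; apply: n0; exists j.
apply: (@affine_mapI _ _ _ h (fun x => L x 0 j / y0 0 j) ((b 0 j - y1 0 j) / y0 0 j)).
  by move=> k u v; rewrite linearP !mxE /GRing.scale/=; ring.
move=> x; have := congr1 (fun v : E => v 0 j) (etrans (esym (fE x)) (fh x)).
rewrite !mxE => e; apply: (mulIf yj); rewrite mulrDl !divfK//.
by apply: (lincomb1 (-1) e); ring.
Qed.

Lemma oscillating_nonconst (f : E -> E) r w : 1 < r -> case_oscillating f r ->
  ~ (forall x, Wfun f x = w).
Proof.
move=> r1 osc Wc; have r0 : 0 < r by apply: lt_trans r1.
have rV1 : r^-1 < 1 by rewrite invf_lt1.
have val v : r^-1 <= v <= r -> v = w.
  by move=> /osc /infinite_setN0[x /= <-].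
have h1 : r = w by apply: val; rewrite lexx andbT; lra.
have h2 : r^-1 = w by apply: val; rewrite lexx/=; lra.
lra.
Qed.
End Exclusion.

Unset Implicit Arguments.

Theorem theorem4p1 (R : realType) :
  (forall f : 'rV[R]_2 -> 'rV[R]_2,
     smooth f -> spacelike_stationary f ->
     let case_i := exists r : R, 0 < r /\ case_affine f r in
     let case_ii := case_lightlike f in
     let case_iii := exists r : R, 1 < r /\ case_oscillating f r in
     [/\ case_i \/ case_ii \/ case_iii,
         ~ (case_i /\ case_ii),
         ~ (case_i /\ case_iii) &
         ~ (case_ii /\ case_iii)]) /\
  (forall r : R, 0 < r ->
     exists f : 'rV[R]_2 -> 'rV[R]_2,
       [/\ smooth f, spacelike_stationary f & case_affine f r]) /\
  (forall r : R, 1 < r ->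
     exists f : 'rV[R]_2 -> 'rV[R]_2,
       [/\ smooth f, spacelike_stationary f & case_oscillating f r]).
Proof.
split; last by split; [exact: affine_example|exact: oscillating_example].
move=> f sf stat case_i case_ii case_iii.
have [a [b [c cs]]] := stationary_conformal sf stat.
have J x := jorgens (cs_smooth_a cs) (cs_smooth_b cs) (cs_smooth_c cs) (cs_det cs)
  (cs_closed_ab cs) (cs_closed_bc cs) (cs_c_gt0 cs) x 0.
have aE : a = cst (a 0) by apply/funext => x; have [] := J x.
have bE : b = cst (b 0) by apply/funext => x; have [] := J x.
have cE : c = cst (c 0) by apply/funext => x; have [] := J x.
rewrite aE bE cE in cs.
split.
(* The quantity tested is |alpha beta|^2: zero leaves cases (i) and (ii), nonzero leaves (i) and
   (iii). *)
- have [k0|k0] := eqVneq (((1 - b 0 ^+ 2) / c 0 ^+ 2 - 1) ^+ 2 + (- 2 * b 0 / c 0 ^+ 2) ^+ 2) 0.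
    move/eqP: k0; rewrite paddr_eq0 ?sqr_ge0// !sqrf_eq0 => /andP[/eqP k1 /eqP k2].
    have [h|h] := degenerate_classify cs k1 k2; last by right; left.
    by left; exists 1.
  by have [h|h] := nondegenerate_classify sf cs k0; [left|right; right].
- move=> [[r [_ [aff _]]] [[h [y0 [y1 [_ nh y00 _ fE]]]] _]].
  exact: nh (affine_lightlike_factor aff y00 fE).
- by move=> [[r [_ [_ Wr]]] [r' [r'1 osc]]]; exact: oscillating_nonconst r'1 osc Wr.
- by move=> [[_ W1] [r [r1 osc]]]; exact: oscillating_nonconst r1 osc W1.
Qed.
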